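(* For every centered infinitely divisible random vector $X$ in $\mathbb{R}^d$ with finite second moment and Lévy measure $\nu$, $$\{t\in\mathbb{R}^d:C_X(t)=0\}=\{t\in\mathbb{R}^d:b_X(t)=0\}=\bigl(\overline{\operatorname{cone}}(\operatorname{supp}\nu)\bigr)^\circ.$$
   Context: $X$ is a centered infinitely divisible random vector in $\mathbb{R}^d$ with finite second moment, covariance matrix $\Sigma$ and Lévy measure $\nu$; $K_X(t):=\log\mathbb{E}e^{\langle t,X\rangle}$ (value $+\infty$ allowed) and $V_X(t):=t^\top\Sigma t$. Directional (radial) pole: if $V_X(t)>0$, $C_X(t)\in[0,\infty]$ is the infimum of all $c\in[0,\infty)$ such that $$K_X(st)\le\frac{V_X(t)s^2}{2(1-cs)}\qquad\text{for all }0\le s<1/c,$$ with $1/0=\infty$ and $\inf\emptyset=\infty$. If $V_X(t)=0$, $C_X(t):=0$. The positive jump radius is $b_X(t)=\sup_{x\in\operatorname{supp}\nu}\langle t,x\rangle_+\in[0,\infty]$ with $z_+=\max\{z,0\}$ (the support function of $\operatorname{supp}\nu\cup\{0\}$; it equals $0$ if $\nu=0$). $\overline{\operatorname{cone}}(S)$ is the closed conic hull of $S$ (equal to $\{0\}$ if $S=\emptyset$), and for a cone $K\subset\mathbb{R}^d$ the polar cone is $K^\circ=\{t:\langle t,x\rangle\le0\text{ for every }x\in K\}$. *)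

(* Defs.v *)
From HB Require Import structures.
From mathcomp Require Import all_boot all_order all_algebra.
From mathcomp Require Import all_classical all_reals all_analysis.

Set Implicit Arguments.
Unset Strict Implicit.
Unset Printing Implicit Defensive.

Import Order.TTheory GRing.Theory Num.Theory.
Import numFieldNormedType.Exports.

Local Open Scope classical_set_scope.
Local Open Scope ring_scope.

(* Borel sigma-algebra of R^d: the library provides none on matrices. *)
HB.instance Definition _ (R : realType) (d : nat) :=
  @isMeasurable.Build (sigma_display (@open 'rV[R]_d)) 'rV[R]_d
    <<s @open 'rV[R]_d >> (@sigma_algebra0 _ setT (@open 'rV[R]_d))
    (@sigma_algebraC _ (@open 'rV[R]_d))
    (@sigma_algebra_bigcup _ setT (@open 'rV[R]_d)).

Definition dotv (R : realType) (d : nat) (u v : 'rV[R]_d) : R :=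
  \sum_(i < d) u ord0 i * v ord0 i.

(* The library norm on matrices is the sup norm, hence this definition. *)
Definition eucl_norm (R : realType) (d : nat) (x : 'rV[R]_d) : R :=
  Num.sqrt (dotv x x).

Definition quad_form (R : realType) (d : nat) (S : 'M[R]_d) (t : 'rV[R]_d) : R :=
  (t *m S *m t^T) ord0 ord0.

Definition psd (R : realType) (d : nat) (S : 'M[R]_d) : Prop :=
  S^T = S /\ forall t : 'rV[R]_d, 0 <= quad_form S t.

Section random_vectors.
Context (disp : measure_display) (Omega : measurableType disp) (R : realType).
Variables (P : probability Omega R) (d : nat).

Definition finite_second_moment (X : {RV P >-> 'rV[R]_d}) : Prop :=
  ('E_P[fun w => (eucl_norm (X w) ^+ 2)%R] < +oo)%E.

Definition centered (X : {RV P >-> 'rV[R]_d}) : Prop :=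
  forall i : 'I_d, ('E_P[fun w => X w ord0 i] = 0)%E.

Definition mutually_independent (n : nat)
    (Y : 'I_n -> {RV P >-> 'rV[R]_d}) : Prop :=
  forall (J : {set 'I_n}) (B : 'I_n -> set 'rV[R]_d),
    (forall i, measurable (B i)) ->
    P (\bigcap_(i in [set i | i \in J]) Y i @^-1` B i) =
    (\prod_(i in J) P (Y i @^-1` B i))%E.

Definition covariance_matrix (X : {RV P >-> 'rV[R]_d}) : 'M[R]_d :=
  \matrix_(i, j) fine (covariance P (fun w => X w ord0 i) (fun w => X w ord0 j)).

Definition dir_variance (X : {RV P >-> 'rV[R]_d}) (t : 'rV[R]_d) : R :=
  quad_form (covariance_matrix X) t.

Definition cumulant_gen_fun (X : {RV P >-> 'rV[R]_d}) (t : 'rV[R]_d) : \bar R :=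
  lne ('E_P[fun w => expR (dotv t (X w))])%E.

(* In \bar R the conventions are 0^-1 = +oo and ereal_inf set0 = +oo. *)
Definition radial_pole (X : {RV P >-> 'rV[R]_d}) (t : 'rV[R]_d) : \bar R :=
  if 0 < dir_variance X t then
    ereal_inf [set c%:E | c in [set c : R | 0 <= c /\
      forall s : R, 0 <= s -> (s%:E < (c%:E)^-1)%E ->
        (cumulant_gen_fun X (s *: t) <=
         (dir_variance X t * s ^+ 2 / (2 * (1 - c * s)))%:E)%E]]
  else 0%E.

(* Real and imaginary parts of the Levy-Khintchine exponent
     i<gamma,u> - u A u^T / 2
       + \int (e^(i<u,x>) - 1 - i<u,x> 1_(|x| <= 1)) nu(dx).                *)
Definition LK_exponent_Re (A : 'M[R]_d) (nu : {measure set 'rV[R]_d -> \bar R})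
    (u : 'rV[R]_d) : R :=
  - (quad_form A u / 2) + \int[nu]_x (cos (dotv u x) - 1).

Definition LK_exponent_Im (gamma : 'rV[R]_d)
    (nu : {measure set 'rV[R]_d -> \bar R}) (u : 'rV[R]_d) : R :=
  dotv gamma u +
  \int[nu]_x (sin (dotv u x) - (if eucl_norm x <= 1 then dotv u x else 0)).

(* nu is the Levy measure of X: it is a Levy measure, and it is the jump part
   of a triplet (gamma, A, nu) for which E e^(i<u,X>) is the exponential of
   the Levy-Khintchine exponent (stated on real and imaginary parts).        *)
Definition is_levy_measure_of (X : {RV P >-> 'rV[R]_d})
    (nu : {measure set 'rV[R]_d -> \bar R}) : Prop :=
  [/\ nu [set 0] = 0%E,
      (\int[nu]_x (Num.min 1 (eucl_norm x ^+ 2))%R%:E < +oo)%E &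
      exists (gamma : 'rV[R]_d) (A : 'M[R]_d), psd A /\
        forall u : 'rV[R]_d,
          ('E_P[fun w => cos (dotv u (X w))])%E =
            (expR (LK_exponent_Re A nu u) *
             cos (LK_exponent_Im gamma nu u))%:E /\
          ('E_P[fun w => sin (dotv u (X w))])%E =
            (expR (LK_exponent_Re A nu u) *
             sin (LK_exponent_Im gamma nu u))%:E].

End random_vectors.

Definition infinitely_divisible (disp : measure_display)
    (Omega : measurableType disp) (R : realType) (P : probability Omega R)
    (d : nat) (X : {RV P >-> 'rV[R]_d}) : Prop :=
  forall n : nat, (0 < n)%N ->
    exists (disp' : measure_display) (Omega' : measurableType disp')
      (P' : probability Omega' R) (Y : 'I_n -> {RV P' >-> 'rV[R]_d}),
    [/\ mutually_independent Y,
        forall (i j : 'I_n) (B : set 'rV[R]_d), measurable B ->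
          distribution P' (Y i) B = distribution P' (Y j) B &
        forall B : set 'rV[R]_d, measurable B ->
          distribution P X B = P' ((fun w => \sum_(i < n) Y i w) @^-1` B)].

Section support_and_cones.
Context (R : realType) (d : nat).

Definition msupport (nu : {measure set 'rV[R]_d -> \bar R}) : set 'rV[R]_d :=
  [set x | forall U : set 'rV[R]_d, open U -> U x -> (0 < nu U)%E].

(* Adjoining the origin, where <t,x>_+ = 0, gives the value 0 when the
   support is empty (in \bar R, the supremum of the empty set is -oo).       *)
Definition positive_jump_radius (nu : {measure set 'rV[R]_d -> \bar R})
    (t : 'rV[R]_d) : \bar R :=
  ereal_sup [set (Num.max (dotv t x) 0)%:E | x in msupport nu `|` [set 0]].

(* The empty combination (n = 0) puts 0 in the hull of every set. *)
Definition conic_hull (S : set 'rV[R]_d) : set 'rV[R]_d :=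
  [set x | exists (n : nat) (a : 'I_n -> R) (y : 'I_n -> 'rV[R]_d),
    (forall i, 0 <= a i /\ S (y i)) /\ x = \sum_(i < n) a i *: y i].

Definition closed_conic_hull (S : set 'rV[R]_d) : set 'rV[R]_d :=
  closure (conic_hull S).

Definition polar_cone (K : set 'rV[R]_d) : set 'rV[R]_d :=
  [set t | forall x, K x -> dotv t x <= 0].

End support_and_cones.

(* Main.v *)
Require Import Defs.
From mathcomp Require Import all_boot all_order all_algebra.
From mathcomp Require Import ring lra.
From mathcomp Require Import all_classical all_reals all_analysis measurable_realfun.

(* Fix t and put Y = <t,X>, y = <t,x>.  Differentiating the Levy-Khintchine
   formula for Y gives, for f = cos(v .) and f = sin(v .), the Stein identity
     E[Y f(Y)] = q E f'(Y) + \int y E[f(Y + y) - f(Y)] nu(dx),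
   where q is the Gaussian variance; f(r) = r gives Var Y = q + \int y^2 dnu.
   The identity extends to products and bounded limits of trigonometric
   functions, hence to bounded substitutes for e^(s r).
   If y <= 0 nu-a.e., then y (e^(s(Y+y)) - e^(sY)) <= s y^2 e^(sY), so that
   E[Y e^(sY)] <= s Var(Y) E e^(sY), and Gronwall gives K_X(st) <= V_X(t) s^2/2.
   Conversely a positive jump makes E[Y e^(sY)] / E e^(sY) grow exponentially
   in s, which K_X(st) <= V_X(t) s^2/2 forbids. *)

Set Implicit Arguments.
Unset Strict Implicit.
Unset Printing Implicit Defensive.

Import Order.TTheory GRing.Theory Num.Theory.
Import numFieldNormedType.Exports.
Local Open Scope classical_set_scope.
Local Open Scope ring_scope.

(** * Integrals of real-valued functions *)

Section integral_tools.
Context disp (T : measurableType disp) (R : realType).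
Variable mu : {measure set T -> \bar R}.
Implicit Types f g : T -> R.

Definition integ f := mu.-integrable setT (EFin \o f).

Lemma integ_measurable f : integ f -> measurable_fun setT f.
Proof. by move/measurable_int/measurable_EFinP. Qed.

Lemma le_integ f g : measurable_fun setT f -> (forall x, `|f x| <= g x) ->
  integ g -> integ f.
Proof.
move=> mf fg; apply: le_integrable => //; first exact/measurable_EFinP.
by move=> x _ /=; rewrite lee_fin (le_trans (fg x))// ler_norm.
Qed.

Lemma integD f g : integ f -> integ g -> integ (fun x => f x + g x).
Proof. by move=> hf hg; exact: (integrableD measurableT hf hg). Qed.

Lemma integB f g : integ f -> integ g -> integ (fun x => f x - g x).
Proof. by move=> hf hg; exact: (integrableB measurableT hf hg). Qed.

Lemma integZ (k : R) f : integ f -> integ (fun x => k * f x).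
Proof. by move=> hf; exact: (integrableZl measurableT k hf). Qed.

Lemma integ_sum (I : Type) (r : seq I) (F : I -> T -> R) :
  (forall i, integ (F i)) -> integ (fun x => \sum_(i <- r) F i x) /\
  \int[mu]_x (\sum_(i <- r) F i x) = \sum_(i <- r) \int[mu]_x F i x.
Proof.
move=> hF; elim: r => [|i r [IH1 IH2]].
  rewrite big_nil (_ : (fun x => _) = cst 0); last first.
    by apply/funext => x; rewrite big_nil.
  split; first exact: integrable0.
  by rewrite Rintegral_cst// mul0r.
rewrite big_cons -IH2 -(RintegralD measurableT (hF i) IH1).
rewrite (_ : (fun x => _) = (fun x => F i x + \sum_(j <- r) F j x)); last first.
  by apply/funext => x; rewrite big_cons.
by split => //; exact: integD.
Qed.

Lemma integ_norm f : integ f -> integ (fun x => `|f x|).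
Proof. by move=> hf; exact: (integrable_norm hf). Qed.

Lemma integ_dct (f_ : (T -> R)^nat) f g :
  (forall n, measurable_fun setT (f_ n)) ->
  (forall x, f_ ^~ x @ \oo --> f x) ->
  integ g -> (forall n x, `|f_ n x| <= g x) ->
  integ f /\ (fun n => \int[mu]_x f_ n x) @ \oo --> \int[mu]_x f x.
Proof.
move=> mf_ cf ig fg.
have mf : measurable_fun setT f.
  by apply: (measurable_fun_cvg mf_) => x _; exact: cf.
have intf : integ f.
  apply: (le_integ mf _ ig) => x.
  have h : `|f_ n x| @[n --> \oo] --> `|f x| by apply: cvg_norm; exact: cf.
  rewrite -(cvg_lim _ h)//; apply: limr_le.
    by apply/cvg_ex; exists `|f x|.
  by apply: nearW => n; exact: fg.
split => //.
have mE (h : T -> R) : measurable_fun setT h -> measurable_fun setT (EFin \o h).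
  by move=> mh; apply/measurable_EFinP.
have cE x : setT x -> (fun n => (f_ n x)%:E) @ \oo --> (f x)%:E.
  by move=> _; apply: cvg_EFin; [exact: nearW|exact: cf].
have [_ _] := dominated_convergence measurableT (fun n => mE _ (mf_ n)) (mE _ mf)
  (aeW mu cE) ig (aeW mu (fun x n _ => fg n x)).
move=> h; apply: fine_cvg; rewrite fineK; last exact: integrable_fin_num.
exact: h.
Qed.

Lemma measurable_gt f (c : R) : measurable_fun setT f ->
  measurable [set x | c < f x].
Proof.
move=> mf; rewrite (_ : [set x | c < f x] = setT `&` f @^-1` `]c, +oo[%classic).
  by apply: mf => //; exact: measurable_itv.
by rewrite setTI; apply/seteqP; split => x /=; rewrite in_itv/= andbT.
Qed.

Lemma is_derive_Rintegral (M : R) (f df : R -> T -> R) g :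
  (forall u, integ (f u)) -> integ g ->
  (forall (u : R) (x : T), is_derive u 1 (f ^~ x) (df u x)) ->
  (forall (u : R) (x : T), `|u| < M -> `|df u x| <= g x) ->
  forall u : R, `|u| < M ->
    is_derive u 1 (fun u => \int[mu]_x f u x) (\int[mu]_x df u x).
Proof.
move=> hf hg hd hb u uM.
have d1 v x : partial1of2 f v x = df v x.
  by rewrite partial1of2E; have [_ ->] := hd v x.
have iu : `](- M), M[%classic u by move: uM; rewrite ltr_norml /= in_itv.
have g0 x : 0 <= g x by apply: le_trans (hb u x uM).
have hh : forall x y, `](- M), M[%classic x -> setT y -> `|partial1of2 f x y| <= g y.
  move=> v x; rewrite /= in_itv /= -ltr_norml d1 => vM _; exact: hb.
have hdd x y : `](- M), M[%classic x -> [set: T] y -> derivable (f ^~ y) x 1.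
  by move=> _ _; have [] := hd x y.
have hI : forall x, `](- M), M[%classic x -> mu.-integrable setT (EFin \o f x).
  by move=> x _; exact: hf.
have D := derivable_under_integral measurableT iu hI hdd g0 hg hh.
apply: DeriveDef => //.
rewrite -derive1E (differentiation_under_integral measurableT iu hI hdd g0 hg hh).
by apply: eq_Rintegral => x _; rewrite d1.
Qed.

Lemma integ_fatou (f_ : (T -> R)^nat) f c :
  (forall n, integ (f_ n)) -> (forall n x, 0 <= f_ n x) ->
  (forall x, f_ ^~ x @ \oo --> f x) -> (forall n, \int[mu]_x f_ n x <= c) ->
  integ f /\ \int[mu]_x f x <= c.
Proof.
move=> if_ f_0 cf fc.
have mf_ n : measurable_fun setT (EFin \o f_ n).
  by apply/measurable_EFinP; exact: integ_measurable.
have mf : measurable_fun setT f.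
  by apply: (measurable_fun_cvg (fun n => integ_measurable (if_ n))) => x _; exact: cf.
have f0 x : 0 <= f x.
  by apply: (cvgr_to_ge (cf x)); apply: nearW => n; exact: f_0.
have ifc n : (\int[mu]_x (f_ n x)%:E <= c%:E)%E.
  by rewrite -[leLHS]fineK ?lee_fin; [exact: fc|exact: integrable_fin_num (if_ n)].
have hle : (\int[mu]_x (f x)%:E <= c%:E)%E.
  have := @fatou _ _ _ mu setT measurableT (fun n => EFin \o f_ n) mf_
    (fun n x _ => f_0 n x).
  rewrite (_ : (fun x => _) = EFin \o f); last first.
    apply/funext => x; have h : (EFin \o f_ n) x @[n --> \oo] --> (f x)%:E.
      by apply: cvg_EFin; [exact: nearW|exact: cf].
    by rewrite (cvg_limn_einf_sup h).
  move=> /le_trans; apply; rewrite limn_einf_lim.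
  apply: lime_le; first exact: is_cvg_einfs.
  apply: nearW => n; apply: le_trans (ifc n); apply: ereal_inf_lbound.
  by exists n => /=.
have intf : integ f.
  apply/integrableP; split; first exact/measurable_EFinP.
  rewrite (_ : (\int[mu]_x _)%E = (\int[mu]_x (f x)%:E)%E); last first.
    by apply: eq_integral => x _; rewrite /= ger0_norm.
  exact: le_lt_trans hle (ltry _).
by split => //; rewrite -lee_fin fineK//; exact: integrable_fin_num intf.
Qed.

Lemma le_Rintegral_ae (N : set T) f g : measurable N -> mu N = 0%E ->
  integ f -> integ g -> (forall x, ~ N x -> f x <= g x) ->
  \int[mu]_x f x <= \int[mu]_x g x.
Proof.
move=> mN N0 hf hg fg; have mD := measurableD measurableT mN.
rewrite /Rintegral (negligible_integral mN measurableT hf N0).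
rewrite (negligible_integral mN measurableT hg N0).
apply: le_Rintegral => //.
- exact: integrableS hf.
- exact: integrableS hg.
- by move=> x [_ Nx]; exact: fg.
Qed.

End integral_tools.

(** * Bounded C1 functions with their derivatives *)

Section jets.
Variable R : realType.

(* A jet pairs a function with its derivative; [jmul] is the Leibniz rule. *)
Definition jet := ((R -> R) * (R -> R))%type.
Implicit Types p s : jet.

Definition jmul p s : jet :=
  (fun r => p.1 r * s.1 r, fun r => p.2 r * s.1 r + p.1 r * s.2 r).
Definition jadd p s : jet := (fun r => p.1 r + s.1 r, fun r => p.2 r + s.2 r).
Definition jscale (k : R) p : jet := (fun r => k * p.1 r, fun r => k * p.2 r).
Definition jone : jet := (fun=> 1, fun=> 0).
Definition jcos (v : R) : jet :=
  (fun r => cos (v * r), fun r => - (v * sin (v * r))).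
Definition jsin (v : R) : jet :=
  (fun r => sin (v * r), fun r => v * cos (v * r)).
Definition jexp p : jet :=
  (fun r => expR (p.1 r), fun r => p.2 r * expR (p.1 r)).

Record C1b (C : R) p : Prop := MkC1b {
  C1b_le : forall r, `|p.1 r| <= C;
  C1b_dle : forall r, `|p.2 r| <= C;
  C1b_derive : forall r : R, is_derive r 1 p.1 (p.2 r);
  C1b_dcontinuous : continuous p.2 }.

Definition bounded_jet p := exists C, C1b C p.

Lemma is_derive_continuous (f df : R -> R) :
  (forall r : R, is_derive r 1 f (df r)) -> continuous f.
Proof.
move=> hf r; apply/differentiable_continuous/derivable1_diffP.
by have [] := hf r.
Qed.

Lemma is_derive_lip (f df : R -> R) (C : R) :
  (forall r : R, is_derive r 1 f (df r)) -> (forall r, `|df r| <= C) ->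
  forall a b, `|f a - f b| <= C * `|a - b|.
Proof.
move=> hf hC a b; wlog ab : a b / b <= a.
  move=> h; have [|ba] := leP b a; first exact: h.
  by rewrite distrC [X in _ * X]distrC h// ltW.
have [c _ ->] := MVT_segment ab (fun x _ => hf x)
  (continuous_subspaceT (is_derive_continuous hf)).
by rewrite normrM ler_wpM2r.
Qed.

Lemma C1b_continuous C p : C1b C p -> continuous p.1.
Proof. by case=> _ _ + _; exact: is_derive_continuous. Qed.

Lemma C1b_ge0 C p : C1b C p -> 0 <= C.
Proof. by case=> /(_ 0) + _ _ _; apply: le_trans. Qed.

Lemma C1b_lip C p a b : C1b C p -> `|p.1 a - p.1 b| <= C * `|a - b|.
Proof. by case=> _ h1 h2 _; exact: is_derive_lip h2 h1 a b. Qed.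

Lemma C1b_mul C D p s : C1b C p -> C1b D s -> C1b (2 * (C * D)) (jmul p s).
Proof.
move=> hp hs; have C0 := C1b_ge0 hp; have D0 := C1b_ge0 hs.
have cp := C1b_continuous hp; have cs := C1b_continuous hs.
case: hp => p1 p2 p3 p4; case: hs => s1 s2 s3 s4; split.
- move=> r /=; rewrite normrM (le_trans (ler_pM _ _ (p1 r) (s1 r)))//.
  by rewrite ler_peMl ?mulr_ge0// ler1n.
- move=> r /=; rewrite (le_trans (ler_normD _ _))// !normrM mulr_natl mulr2n.
  by rewrite lerD// ler_pM.
- move=> r; apply: is_derive_eq => /=.
  by rewrite [LHS]addrC; congr (_ + _); rewrite mulrC.
- by move=> r /=; apply: cvgD; apply: cvgM;
    [exact: p4|exact: cs|exact: cp|exact: s4].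
Qed.

Lemma C1b_add C D p s : C1b C p -> C1b D s -> C1b (C + D) (jadd p s).
Proof.
case=> p1 p2 p3 p4 [s1 s2 s3 s4]; split.
- by move=> r /=; rewrite (le_trans (ler_normD _ _))// lerD.
- by move=> r /=; rewrite (le_trans (ler_normD _ _))// lerD.
- by move=> r; apply: is_derive_eq.
- by move=> r /=; apply: cvgD; [exact: p4|exact: s4].
Qed.

Lemma C1b_scale C k p : C1b C p -> C1b (`|k| * C) (jscale k p).
Proof.
case=> p1 p2 p3 p4; split.
- by move=> r /=; rewrite normrM ler_wpM2l.
- by move=> r /=; rewrite normrM ler_wpM2l.
- move=> r; apply: is_derive_eq => //=.
- by move=> r /=; apply: cvgM; [exact: cvg_cst|exact: p4].
Qed.

Lemma C1b_one : C1b 1 jone.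
Proof.
split => [r|r|r|r] /=; rewrite ?normr1 ?normr0//; last exact: cvg_cst.
exact: is_derive_cst.
Qed.

Lemma C1b_cos v : C1b (1 + `|v|) (jcos v).
Proof.
split.
- by move=> r /=; rewrite (le_trans (cos_max _))// lerDl.
- move=> r /=; rewrite normrN normrM.
  by rewrite (le_trans (ler_wpM2l _ (sin_max _)))// mulr1 lerDr.
- move=> r /=; apply: is_derive_eq.
  by rewrite /GRing.scale /= mulr1 mulNr mulrC.
- move=> r /=; apply: cvgN; apply: cvgM; first exact: cvg_cst.
  apply: continuous_comp; last exact: continuous_sin.
  by apply: cvgM; [exact: cvg_cst|exact: cvg_id].
Qed.

Lemma C1b_sin v : C1b (1 + `|v|) (jsin v).
Proof.
split.
- by move=> r /=; rewrite (le_trans (sin_max _))// lerDl.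
- move=> r /=; rewrite normrM.
  by rewrite (le_trans (ler_wpM2l _ (cos_max _)))// mulr1 lerDr.
- move=> r /=; apply: is_derive_eq.
  by rewrite /GRing.scale /= mulr1 mulrC.
- move=> r /=; apply: cvgM; first exact: cvg_cst.
  apply: continuous_comp; last exact: continuous_cos.
  by apply: cvgM; [exact: cvg_cst|exact: cvg_id].
Qed.

Lemma C1b_exp C p : C1b C p -> C1b ((1 + C) * expR C) (jexp p).
Proof.
move=> hp; have C0 := C1b_ge0 hp; have cp := C1b_continuous hp.
have be r : expR (p.1 r) <= expR C.
  by rewrite ler_expR (le_trans (ler_norm _))// (C1b_le hp).
have ce : continuous (fun r => expR (p.1 r)).
  by move=> r; apply: continuous_comp; [exact: cp|exact: continuous_expR].
case: hp => p1 p2 p3 p4; split.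
- move=> r /=; rewrite ger0_norm ?expR_ge0// (le_trans (be r))//.
  by rewrite ler_peMl ?expR_ge0// lerDl.
- move=> r /=; rewrite normrM (ger0_norm (expR_ge0 _)) ler_pM ?expR_ge0//.
  by rewrite (le_trans (p2 r))// lerDr.
- by move=> r /=; apply: is_derive_eq; rewrite mulrC.
- by move=> r /=; apply: cvgM; [exact: p4|exact: ce].
Qed.

Fixpoint jpow p (n : nat) : jet :=
  if n is k.+1 then jmul (jpow p k) p else jone.

Fixpoint jexp_sum p (n : nat) : jet :=
  if n is k.+1 then jadd (jexp_sum p k) (jscale k`!%:R^-1 (jpow p k))
  else jscale 0 jone.

Lemma jpow1 p n r : (jpow p n).1 r = p.1 r ^+ n.
Proof. by elim: n => [|n IH] //=; rewrite IH exprSr. Qed.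

Lemma jpow2 p n r : (jpow p n.+1).2 r = n.+1%:R * p.1 r ^+ n * p.2 r.
Proof.
elim: n => [|n IH]; first by rewrite /= expr0; ring.
rewrite -[LHS]/((jpow p n.+1).2 r * p.1 r + (jpow p n.+1).1 r * p.2 r) IH jpow1.
by rewrite -[n.+2%:R]natr1 !exprS; ring.
Qed.

Lemma jexp_sum1 p n r : (jexp_sum p n).1 r = series (exp_coeff (p.1 r)) n.
Proof.
rewrite /series /=; elim: n => [|n IH] /=; first by rewrite big_geq// mul0r.
by rewrite big_nat_recr//= IH jpow1 /exp_coeff /= [_^-1 * _]mulrC.
Qed.

Lemma jexp_sum2 p n r :
  (jexp_sum p n.+1).2 r = p.2 r * series (exp_coeff (p.1 r)) n.
Proof.
elim: n => [|n IH].
  by rewrite /= /series /= big_geq// !mulr0 !addr0.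
rewrite -[LHS]/((jexp_sum p n.+1).2 r + n.+1`!%:R^-1 * (jpow p n.+1).2 r).
rewrite IH jpow2 /series /= big_nat_recr//= mulrDr; congr (_ + _).
rewrite factS natrM invfM /exp_coeff /=.
have n0 : n.+1%:R != 0 :> R by rewrite pnatr_eq0.
have f0 : n`!%:R != 0 :> R by rewrite pnatr_eq0 -lt0n fact_gt0.
by field; rewrite f0 [1 + _]addrC natr1.
Qed.

Lemma cvg_exp_series (x : R) : series (exp_coeff x) @ \oo --> expR x.
Proof. by have := is_cvg_series_exp_coeff x. Qed.

Lemma exp_series_le (x C : R) n : `|x| <= C -> `|series (exp_coeff x) n| <= expR C.
Proof.
move=> xC; have C0 : 0 <= C by apply: le_trans xC.
apply: (@le_trans _ _ (series (exp_coeff C) n)).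
  rewrite /series /= (le_trans (ler_norm_sum _ _ _))// ler_sum// => i _.
  rewrite /exp_coeff /= normrM normrX [X in _ * X]ger0_norm ?invr_ge0//.
  by rewrite ler_wpM2r ?invr_ge0// lerXn2r ?nnegrE.
apply: (nondecreasing_cvgn_le _ (is_cvg_series_exp_coeff C)).
by apply/nondecreasing_seqP => k; rewrite /series /= big_nat_recr//= lerDl exp_coeff_ge0.
Qed.

Lemma C1b_exp_sum C p n : C1b C p -> C1b ((1 + C) * expR C) (jexp_sum p n).
Proof.
move=> hp; have C0 := C1b_ge0 hp.
have [D hD] : exists D, C1b D (jexp_sum p n).
  elim: n => [|n [D hD]] /=; first by eexists; exact: C1b_scale C1b_one.
  have [E hE] : exists E, C1b E (jpow p n).
    elim: {hD} n => [|n [E hE]] /=; first by eexists; exact: C1b_one.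
    by eexists; exact: C1b_mul hE hp.
  by eexists; apply: C1b_add hD (C1b_scale _ hE).
case: hD => _ _ h3 h4; split => // r.
  rewrite jexp_sum1 (le_trans (exp_series_le _ (C1b_le hp r)))//.
  by rewrite ler_peMl ?expR_ge0// lerDl.
case: n {h3 h4} => [|n]; first by rewrite /= mulr0 normr0 mulr_ge0 ?addr_ge0 ?expR_ge0.
rewrite jexp_sum2 normrM ler_pM//; last exact: exp_series_le (C1b_le hp r).
by rewrite (le_trans (C1b_dle hp r))// lerDr.
Qed.

Lemma cvg_jexp_sum1 p r : (fun n => (jexp_sum p n).1 r) @ \oo --> (jexp p).1 r.
Proof.
rewrite (_ : (fun n => _) = series (exp_coeff (p.1 r))); first exact: cvg_exp_series.
by apply/funext => n; exact: jexp_sum1.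
Qed.

Lemma cvg_jexp_sum2 p r : (fun n => (jexp_sum p n).2 r) @ \oo --> (jexp p).2 r.
Proof.
rewrite -cvg_shiftS.
rewrite (_ : (fun n => _) = (fun n => p.2 r * series (exp_coeff (p.1 r)) n)).
  by apply: cvgM; [exact: cvg_cst|exact: cvg_exp_series].
by apply/funext => n; exact: jexp_sum2.
Qed.

(* Periodic substitute for the identity; it tends to it as n grows. *)
Definition jwave (n : nat) : jet := jscale n.+1%:R (jsin n.+1%:R^-1).

Lemma jwave2 n r : (jwave n).2 r = cos (n.+1%:R^-1 * r).
Proof. by rewrite /= mulrA divff ?mul1r// pnatr_eq0. Qed.

Lemma bounded_jwave n : bounded_jet (jwave n).
Proof. by eexists; exact: C1b_scale (C1b_sin _). Qed.

Lemma jwave_lip n a b : `|(jwave n).1 a - (jwave n).1 b| <= `|a - b|.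
Proof.
have [C hC] := bounded_jwave n.
rewrite -[leRHS]mul1r; apply: is_derive_lip (C1b_derive hC) _ a b => r.
by rewrite jwave2 cos_max.
Qed.

Lemma jwave_le n r : `|(jwave n).1 r| <= `|r|.
Proof.
have := jwave_lip n r 0.
by rewrite /= mulr0 sin0 mulr0 !subr0.
Qed.

Lemma cvg_jwave2 r : (fun n => (jwave n).2 r) @ \oo --> (1 : R).
Proof.
rewrite (_ : (fun n => _) = (fun n => cos (n.+1%:R^-1 * r))); last first.
  by apply/funext => n; exact: jwave2.
rewrite -[X in _ --> X]cos0; apply: continuous_cvg; first exact: continuous_cos.
by rewrite -(mul0r r); apply: cvgM; [exact: cvg_harmonic|exact: cvg_cst].
Qed.

Lemma cvg_jwave1 r : (fun n => (jwave n).1 r) @ \oo --> r.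
Proof.
have [->|r0] := eqVneq r 0.
  by rewrite (_ : (fun n => _) = fun=> 0); [exact: cvg_cst|];
    apply/funext => n /=; rewrite mulr0 sin0 mulr0.
have h0 : h^-1 *: ((@sin R \o shift 0) (h *: 1) - sin 0) @[h --> 0^'] --> (1 : R).
  have [dl d0] := is_derive_sin (0 : R).
  have [l hl] : exists l : R, h^-1 *: ((@sin R \o shift 0) (h *: 1) - sin 0)
    @[h --> 0^'] --> l by apply/cvg_ex; exact: dl.
  suff l1 : l = 1 by rewrite l1 in hl.
  by rewrite -[RHS](@cos0 R) -d0; apply/esym/cvg_lim.
have hu : (forall n, n.+1%:R^-1 * r != 0) /\ n.+1%:R^-1 * r @[n --> \oo] --> (0 : R).
  split; first by move=> n; rewrite mulf_neq0// invr_eq0 pnatr_eq0.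
  by rewrite -[X in _ --> X](mul0r r); apply: cvgM; [exact: cvg_harmonic|exact: cvg_cst].
have := proj1 (cvgr_dnbhsP _ _ _) h0 _ hu => h1.
have h2 : r * ((n.+1%:R^-1 * r)^-1 *:
    ((@sin R \o shift 0) ((n.+1%:R^-1 * r) *: 1) - sin 0)) @[n --> \oo] --> r * 1.
  by apply: cvgM; [exact: cvg_cst|exact: h1].
rewrite mulr1 in h2.
rewrite (_ : (fun n => (jwave n).1 r) = (fun n => r * ((n.+1%:R^-1 * r)^-1 *:
    ((@sin R \o shift 0) ((n.+1%:R^-1 * r) *: 1) - sin 0)))) //.
apply/funext => n /=; rewrite /GRing.scale /= mulr1 addr0 sin0 subr0 invfM invrK.
by rewrite mulrA [r * _]mulrC mulfVK.
Qed.

End jets.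

(** * Bounded approximations of exponentials *)

Section exponential_tests.
Variable R : realType.
Implicit Types s eta r : R.

Lemma mulexpN_le1 (w : R) : 0 <= w -> w * expR (- w) <= 1.
Proof.
move=> w0; rewrite expRN ler_pdivrMr ?expR_gt0// mul1r.
by rewrite (le_trans _ (expR_ge1Dx w))// lerDr.
Qed.

Lemma sqrexpN_le2 (w : R) : 0 <= w -> w ^+ 2 * expR (- w) <= 2.
Proof.
move=> w0; rewrite expRN ler_pdivrMr ?expR_gt0//.
have := expR_ge1Dxn 1 w0; have -> : 2`!%:R = 2 :> R by [].
by lra.
Qed.

Lemma addexpN_le1 (w : R) : 0 <= w -> (1 + w) * expR (- w) <= 1.
Proof. by move=> w0; rewrite expRN ler_pdivrMr ?expR_gt0// mul1r expR_ge1Dx. Qed.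

(* Bounded substitutes for e^(s r) as eta decreases to 0. *)
Definition jsatur eta s : jet R :=
  (fun r => (1 - expR (- (eta * expR (s * r)))) / eta,
   fun r => s * (expR (s * r) * expR (- (eta * expR (s * r))))).

Definition jdamped eta s : jet R :=
  (fun r => expR (s * r) * expR (- (eta * expR (s * r))),
   fun r => s * (1 - eta * expR (s * r)) *
     (expR (s * r) * expR (- (eta * expR (s * r))))).

Lemma jdamped_ge0 eta s r : 0 <= (jdamped eta s).1 r.
Proof. by rewrite mulr_ge0 ?expR_ge0. Qed.

Lemma jdamped_le_inv eta s r : 0 < eta -> (jdamped eta s).1 r <= eta^-1.
Proof.
move=> e0; rewrite -[leRHS]mul1r ler_pdivlMr//= mulrC mulrA.
by apply: mulexpN_le1; rewrite mulr_ge0 ?expR_ge0// ltW.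
Qed.

Lemma jdamped_le_satur eta s r : 0 < eta ->
  (jdamped eta s).1 r <= (jsatur eta s).1 r.
Proof.
move=> e0; rewrite ler_pdivlMr//=.
have w0 : 0 <= eta * expR (s * r) by rewrite mulr_ge0 ?expR_ge0// ltW.
by have := addexpN_le1 w0; lra.
Qed.

Lemma jdamped2_le eta s r : 0 < eta -> 0 <= s ->
  (jdamped eta s).2 r <= s * (jdamped eta s).1 r.
Proof.
move=> e0 s0 /=; rewrite -mulrA ler_wpM2l// ler_piMl ?mulr_ge0 ?expR_ge0//.
by rewrite gerBl mulr_ge0 ?expR_ge0// ltW.
Qed.

Lemma jsatur_ge0 eta s r : 0 < eta -> 0 <= (jsatur eta s).1 r.
Proof. by move=> e0; exact: le_trans (jdamped_ge0 _ _ _) (jdamped_le_satur _ _ e0). Qed.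

Lemma jsatur_le_exp eta s r : 0 < eta -> (jsatur eta s).1 r <= expR (s * r).
Proof.
move=> e0; rewrite ler_pdivrMr//=.
by have := expR_ge1Dx (- (eta * expR (s * r))); lra.
Qed.

Lemma jsatur_le_inv eta s r : 0 < eta -> (jsatur eta s).1 r <= eta^-1.
Proof.
by move=> e0; rewrite /= ler_piMl ?invr_ge0 ?(ltW e0)// gerBl expR_ge0.
Qed.

Lemma is_derive_expM (s r : R) : is_derive r 1 (fun r => expR (s * r)) (s * expR (s * r)).
Proof.
apply: is_derive_eq; rewrite /GRing.scale /= mulr1 mulrC.
by [].
Qed.

Lemma is_derive_exp_expM (eta s r : R) :
  is_derive r 1 (fun r => expR (- (eta * expR (s * r))))
    (- (eta * s * (expR (s * r) * expR (- (eta * expR (s * r)))))).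
Proof.
have h1 := is_derive_expM s r.
have h2 : is_derive r 1 (fun r => - (eta * expR (s * r))) (- (eta * (s * expR (s * r)))).
  by apply: is_derive_eq.
have h3 := is_derive1_comp (is_derive_expR _) h2.
by apply: is_derive_eq h3 _; ring.
Qed.

Lemma continuous_expM s : continuous (fun r => expR (s * r)).
Proof. exact: is_derive_continuous (is_derive_expM s). Qed.

Lemma continuous_exp_expM eta s : continuous (fun r => expR (- (eta * expR (s * r)))).
Proof. exact: is_derive_continuous (is_derive_exp_expM eta s). Qed.

Lemma continuous_jdamped eta s : continuous (jdamped eta s).1.
Proof.
by move=> r; apply: cvgM; [exact: continuous_expM|exact: continuous_exp_expM].
Qed.

Lemma C1b_jsatur eta s : 0 < eta -> C1b ((1 + `|s|) / eta) (jsatur eta s).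
Proof.
move=> e0; have n0 : eta != 0 by rewrite gt_eqF.
split => [r|r|r|r].
- rewrite ger0_norm ?jsatur_ge0// (le_trans (jsatur_le_inv _ _ e0))//.
  by rewrite ler_peMl ?invr_ge0 ?(ltW e0)// lerDl.
- rewrite /= normrM -[X in _ * X <= _]/(`|(jdamped eta s).1 r|).
  rewrite (ger0_norm (jdamped_ge0 _ _ _)) ler_pM// ?jdamped_ge0 ?jdamped_le_inv//.
  by rewrite lerDr.
- have h := is_derive_exp_expM eta s r.
  apply: is_derive_eq.
  by rewrite /GRing.scale /=; field.
- by apply: cvgM; [exact: cvg_cst|exact: continuous_jdamped].
Qed.

Lemma C1b_jdamped eta s : 0 < eta -> C1b ((1 + 3 * `|s|) / eta) (jdamped eta s).
Proof.
move=> e0; have n0 : eta != 0 by rewrite gt_eqF.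
split => [r|r|r|r].
- rewrite ger0_norm ?jdamped_ge0// (le_trans (jdamped_le_inv _ _ e0))//.
  by rewrite ler_peMl ?invr_ge0 ?(ltW e0)// lerDl mulr_ge0.
- rewrite /= -mulrA normrM.
  apply: (@le_trans _ _ (`|s| * (3 / eta))); last first.
    by rewrite mulrA ler_wpM2r ?invr_ge0 ?(ltW e0)// mulrC lerDr.
  rewrite ler_wpM2l// ler_pdivlMr//.
  set w := eta * expR (s * r).
  have w0 : 0 <= w by rewrite mulr_ge0 ?expR_ge0// ltW.
  rewrite -[X in _ * X <= _](ger0_norm (ltW e0)) -normrM.
  rewrite (_ : _ * eta = w * expR (- w) - w ^+ 2 * expR (- w)); last first.
    by rewrite /w; ring.
  have := mulexpN_le1 w0; have := sqrexpN_le2 w0.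
  have : 0 <= w * expR (- w) by rewrite mulr_ge0 ?expR_ge0.
  have : 0 <= w ^+ 2 * expR (- w) by rewrite mulr_ge0 ?expR_ge0 ?sqr_ge0.
  by move=> ? ? ? ?; rewrite ler_norml; apply/andP; split; lra.
- have h1 := is_derive_expM s r; have h := is_derive_exp_expM eta s r.
  apply: is_derive_eq.
  by rewrite /GRing.scale /=; ring.
- apply: cvgM; last exact: continuous_jdamped.
  apply: cvgM; first exact: cvg_cst.
  apply: cvgB; first exact: cvg_cst.
  by apply: cvgM; [exact: cvg_cst|exact: continuous_expM].
Qed.

Lemma jsatur_mono eta s : 0 < eta -> 0 <= s -> {homo (jsatur eta s).1 : a b / a <= b}.
Proof.
move=> e0 s0 a b ab /=; rewrite ler_pM2r ?invr_gt0// lerB// ler_expR lerN2.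
by rewrite ler_pM2l// ler_expR ler_wpM2l.
Qed.

Lemma cvg_jsatur s r : (jsatur n.+1%:R^-1 s).1 r @[n --> \oo] --> expR (s * r).
Proof.
set v := expR (s * r).
apply: (@squeeze_cvgr _ _ _ _ (fun n => v - n.+1%:R^-1 * v ^+ 2) (fun=> v)).
- apply: nearW => n; have e0 : 0 < n.+1%:R^-1 :> R by rewrite invr_gt0.
  rewrite jsatur_le_exp// andbT ler_pdivlMr//= -/v.
  set w := n.+1%:R^-1 * v.
  have w0 : 0 <= w by rewrite mulr_ge0 ?expR_ge0// ltW.
  rewrite (_ : (v - _) * _ = w - w ^+ 2); last by rewrite /w; ring.
  have : expR (- w) <= (1 + w)^-1 by rewrite expRN lef_pV2 ?posrE ?expR_gt0 ?expR_ge1Dx ?ltr_pwDl.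
  suff : (1 + w)^-1 <= 1 - w + w ^+ 2 by lra.
  rewrite -[leLHS]mul1r ler_pdivrMr ?ltr_pwDl//.
  have : 0 <= w ^+ 3 by rewrite exprn_ge0.
  by rewrite !exprS expr0; lra.
- rewrite -[X in _ --> X]subr0 -[X in _ - X](mul0r (v ^+ 2)).
  by apply: cvgB; [exact: cvg_cst|apply: cvgM; [exact: cvg_harmonic|exact: cvg_cst]].
- exact: cvg_cst.
Qed.

Lemma jdamped_jump_le eta s z r : 0 < eta -> 0 <= s -> z <= 0 ->
  z * ((jdamped eta s).1 (r + z) - (jdamped eta s).1 r) <=
  s * z ^+ 2 * (jdamped eta s).1 r.
Proof.
move=> e0 s0 z0; set f := (jdamped eta s).1.
have hf : (1 + s * z) * f r <= f (r + z).
  apply: (@le_trans _ _ (expR (s * z) * f r)).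
    by rewrite ler_wpM2r ?expR_ge1Dx// jdamped_ge0.
  rewrite /f /= mulrA -expRD (_ : s * z + s * r = s * (r + z)); last by ring.
  rewrite ler_wpM2l ?expR_ge0// ler_expR lerN2 ler_pM2l// ler_expR ler_wpM2l//.
  by rewrite gerDl.
by nra.
Qed.

End exponential_tests.

(** * The Stein identity and one-sided exponential moments *)

Section stein_identity.
Context (R : realType) dO (Omega : measurableType dO) (P : probability Omega R).
Context dT (T : measurableType dT) (nu : {measure set T -> \bar R}).
Variables (Y : Omega -> R) (y : T -> R) (q : R).
Hypotheses (mY : measurable_fun setT Y) (Y2 : integ P (fun w => Y w ^+ 2)).
Hypotheses (my : measurable_fun setT y) (y2 : integ nu (fun x => y x ^+ 2)).
Implicit Types (f : R -> R) (p s : jet R).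

Definition Ex f := \int[P]_w f (Y w).

Definition jump f (z : R) := Ex (fun r => f (r + z) - f r).

(* With q the Gaussian variance and [nu] the Levy measure, this is the Stein
   identity E[Y f(Y)] = q E f'(Y) + \int y E[f(Y + y) - f(Y)] nu(dy). *)
Definition stein p :=
  Ex (fun r => r * p.1 r) = q * Ex p.2 + \int[nu]_x (y x * jump p.1 (y x)).

Definition lipschitz_by (C : R) f := forall a b, `|f a - f b| <= C * `|a - b|.

Lemma lipschitz_by_cont C f : lipschitz_by C f -> continuous f.
Proof.
move=> fC r; apply/cvgrPdist_le => e e0.
have C0 : 0 <= C by have := fC 1 0; rewrite subr0 normr1 mulr1; apply: le_trans.
have C1 : 0 < C + 1 by rewrite ltr_wpDl.
near=> x.
rewrite (le_trans (fC _ _))//.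
have h : `|r - x| <= e / (C + 1).
  near: x; apply: cvgr_dist_le; [exact: cvg_id|by rewrite divr_gt0].
rewrite (le_trans (ler_wpM2l C0 h))// mulrCA ler_piMr ?ltW//.
by rewrite ltr_pdivrMr// mul1r ltrDl.
Unshelve. all: by end_near. Qed.

Lemma measurable_contY f : continuous f -> measurable_fun setT (fun w => f (Y w)).
Proof.
by move=> cf; apply: (measurableT_comp (continuous_measurable_fun cf) mY).
Qed.

Lemma measurable_conty f : continuous f -> measurable_fun setT (fun x => f (y x)).
Proof.
by move=> cf; apply: (measurableT_comp (continuous_measurable_fun cf) my).
Qed.

Lemma integ_cst (c : R) : integ P (fun=> c).
Proof. exact: finite_measure_integrable_cst. Qed.

Lemma integ_absY : integ P (fun w => `|Y w|).
Proof.
apply: (@le_integ _ _ _ _ _ (fun w => 1 + Y w ^+ 2)); last first.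
- by apply: integD => //; exact: integ_cst.
- move=> w; rewrite normr_id -real_normK ?num_real//.
  by have := sqr_ge0 (`|Y w| - 1); have := normr_ge0 (Y w); nra.
- exact: measurableT_comp.
Qed.

Lemma integ_Y : integ P Y.
Proof. by apply: (le_integ mY _ integ_absY). Qed.

Lemma integ_bounded C f : continuous f -> (forall r, `|f r| <= C) ->
  integ P (fun w => f (Y w)).
Proof.
move=> cf fC; apply: (le_integ (measurable_contY cf) _ (integ_cst C)) => w.
exact: fC.
Qed.

Lemma integ_linear C D f : continuous f -> (forall r, `|f r| <= C + D * `|r|) ->
  integ P (fun w => f (Y w)).
Proof.
move=> cf fC.
apply: (le_integ (measurable_contY cf) (fun w => fC (Y w))).
by apply: integD; [exact: integ_cst|apply: integZ; exact: integ_absY].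
Qed.

Lemma integ_lip C f z : lipschitz_by C f -> integ P (fun w => f (Y w + z)).
Proof.
move=> fC.
apply: (@integ_linear (`|f z|) C (fun r => f (r + z))).
  move=> r; apply: (@continuous_comp _ _ _ (fun r => r + z) f).
    by apply: cvgD; [exact: cvg_id|exact: cvg_cst].
  exact: (lipschitz_by_cont fC).
move=> r; rewrite -[X in `|X|](subrK (f z)) addrC (le_trans (ler_normD _ _))//.
by rewrite lerD2l (le_trans (fC _ _))// addrK.
Qed.

Lemma integ_lip0 C f : lipschitz_by C f -> integ P (fun w => f (Y w)).
Proof.
by move=> /(@integ_lip _ _ 0); under eq_fun do rewrite addr0.
Qed.

Lemma ExD f g : integ P (fun w => f (Y w)) -> integ P (fun w => g (Y w)) ->
  Ex (fun r => f r + g r) = Ex f + Ex g.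
Proof. by move=> hf hg; rewrite /Ex RintegralD. Qed.

Lemma ExB f g : integ P (fun w => f (Y w)) -> integ P (fun w => g (Y w)) ->
  Ex (fun r => f r - g r) = Ex f - Ex g.
Proof. by move=> hf hg; rewrite /Ex RintegralB. Qed.

Lemma ExZ k f : integ P (fun w => f (Y w)) -> Ex (fun r => k * f r) = k * Ex f.
Proof. by move=> hf; rewrite /Ex RintegralZl. Qed.

Lemma Ex_cst c : Ex (fun=> c) = c.
Proof.
rewrite /Ex Rintegral_cst// -[RHS]mulr1; congr (_ * _).
by rewrite -[RHS]/(fine 1%E); congr fine; exact: probability_setT.
Qed.

Lemma le_Ex f g : integ P (fun w => f (Y w)) -> integ P (fun w => g (Y w)) ->
  (forall r, f r <= g r) -> Ex f <= Ex g.
Proof. by move=> hf hg fg; apply: le_Rintegral => // w _; exact: fg. Qed.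

Lemma norm_Ex_le C f : continuous f -> (forall r, `|f r| <= C) -> `|Ex f| <= C.
Proof.
move=> cf fC; have hf := integ_bounded cf fC.
rewrite (le_trans (le_normr_Rintegral measurableT hf))//.
rewrite -[leRHS]Ex_cst; apply: le_Rintegral => //; first exact: integ_norm hf.
exact: integ_cst.
Qed.

Lemma jumpE C f z : lipschitz_by C f ->
  jump f z = Ex (fun r => f (r + z)) - Ex f.
Proof. by move=> fC; rewrite /jump ExB//; [exact: integ_lip fC|exact: integ_lip0 fC]. Qed.

Lemma jump_lip C f : lipschitz_by C f -> lipschitz_by C (jump f).
Proof.
move=> fC a b; rewrite !(jumpE _ fC).
rewrite (_ : _ - _ = Ex (fun r => f (r + a)) - Ex (fun r => f (r + b))); last by ring.
rewrite -ExB; [|exact: integ_lip fC|exact: integ_lip fC].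
apply: norm_Ex_le.
  have cf c r : {for r, continuous (fun r => f (r + c))}.
    apply: (@continuous_comp _ _ _ (fun r => r + c) f).
      by apply: cvgD; [exact: cvg_id|exact: cvg_cst].
    exact: (lipschitz_by_cont fC).
  by move=> r; apply: cvgB; exact: cf.
move=> r; rewrite (le_trans (fC _ _))//.
by rewrite (_ : r + a - (r + b) = a - b)//; ring.
Qed.

Lemma jump_le C f z : lipschitz_by C f -> `|jump f z| <= C * `|z|.
Proof.
move=> fC; have := jump_lip fC z 0.
rewrite [jump f 0](jumpE _ fC) subr0; under [Ex (fun r => f (r + 0))]eq_Rintegral do rewrite addr0.
by rewrite subrr subr0.
Qed.

Lemma measurable_yjump C f : lipschitz_by C f ->
  measurable_fun setT (fun x => y x * jump f (y x)).
Proof.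
move=> fC; apply: measurable_funM => //; apply: measurable_conty.
exact: lipschitz_by_cont (jump_lip fC).
Qed.

Lemma yjump_le C f x : lipschitz_by C f -> `|y x * jump f (y x)| <= C * y x ^+ 2.
Proof.
move=> fC; rewrite normrM (le_trans (ler_wpM2l _ (jump_le _ fC)))//.
by rewrite mulrCA -expr2 real_normK ?num_real.
Qed.

Lemma integ_yjump C f : lipschitz_by C f -> integ nu (fun x => y x * jump f (y x)).
Proof.
move=> fC; apply: (le_integ (measurable_yjump fC) (fun x => yjump_le x fC)).
exact: integZ.
Qed.

Lemma C1b_lipschitz C p : C1b C p -> lipschitz_by C p.1.
Proof. by move=> hp a b; exact: C1b_lip hp. Qed.

Lemma integ_Yjet C p : C1b C p -> integ P (fun w => Y w * p.1 (Y w)).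
Proof.
move=> hp; apply: (@integ_linear 0 C (fun r => r * p.1 r)).
  by move=> r; apply: cvgM; [exact: cvg_id|exact: C1b_continuous hp r].
by move=> r; rewrite add0r normrM mulrC ler_wpM2r// (C1b_le hp).
Qed.

Lemma integ_jet1 C p : C1b C p -> integ P (fun w => p.1 (Y w)).
Proof. by move=> hp; apply: integ_bounded (C1b_continuous hp) (C1b_le hp). Qed.

Lemma integ_jet2 C p : C1b C p -> integ P (fun w => p.2 (Y w)).
Proof. by move=> hp; apply: integ_bounded (C1b_dcontinuous hp) (C1b_dle hp). Qed.

Lemma steinD C D p s : C1b C p -> C1b D s -> stein p -> stein s -> stein (jadd p s).
Proof.
move=> hp hs sp ss; rewrite /stein /=.
rewrite (_ : (fun r => _) = (fun r => r * p.1 r + r * s.1 r)); last first.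
  by apply/funext => r; ring.
rewrite [LHS](@ExD (fun r => r * p.1 r) (fun r => r * s.1 r)
  (integ_Yjet hp) (integ_Yjet hs)).
rewrite sp ss (@ExD p.2 s.2 (integ_jet2 hp) (integ_jet2 hs)).
have jE z : jump (fun r => p.1 r + s.1 r) z = jump p.1 z + jump s.1 z.
  rewrite (jumpE _ (C1b_lipschitz (C1b_add hp hs))) /=.
  have lp := C1b_lipschitz hp; have ls := C1b_lipschitz hs.
  rewrite ExD; [|exact: integ_lip lp|exact: integ_lip ls].
  rewrite ExD; [|exact: integ_lip0 lp|exact: integ_lip0 ls].
  by rewrite (jumpE _ lp) (jumpE _ ls); ring.
under [X in _ = _ + X]eq_Rintegral do rewrite jE mulrDr.
rewrite (RintegralD measurableT (integ_yjump (C1b_lipschitz hp))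
  (integ_yjump (C1b_lipschitz hs))).
by rewrite mulrDr addrACA.
Qed.

Lemma steinZ C k p : C1b C p -> stein p -> stein (jscale k p).
Proof.
move=> hp sp; rewrite /stein /=.
rewrite (_ : (fun r => _) = (fun r => k * (r * p.1 r))); last first.
  by apply/funext => r; ring.
rewrite [LHS](@ExZ k (fun r => r * p.1 r) (integ_Yjet hp)).
rewrite sp (@ExZ k p.2 (integ_jet2 hp)).
have jE z : jump (fun r => k * p.1 r) z = k * jump p.1 z.
  have lp := C1b_lipschitz hp.
  rewrite (jumpE _ (C1b_lipschitz (C1b_scale k hp))) (jumpE _ lp) /=.
  by rewrite ExZ ?ExZ; [ring|exact: integ_lip0 lp|exact: integ_lip lp].
under [X in _ = _ + X]eq_Rintegral do rewrite jE mulrCA.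
by rewrite RintegralZl//; [ring|exact: integ_yjump (C1b_lipschitz hp)].
Qed.

Lemma stein_lim C (p_ : (jet R)^nat) p : (forall n, C1b C (p_ n)) ->
  (forall r, (p_ n).1 r @[n --> \oo] --> p.1 r) ->
  (forall r, (p_ n).2 r @[n --> \oo] --> p.2 r) ->
  (forall n, stein (p_ n)) -> stein p.
Proof.
move=> hC h1 h2 hs.
have [_ c1] : integ P (fun w => Y w * p.1 (Y w)) /\
    Ex (fun r => r * (p_ n).1 r) @[n --> \oo] --> Ex (fun r => r * p.1 r).
  apply: (@integ_dct _ _ _ P (fun n w => Y w * (p_ n).1 (Y w))
    (fun w => Y w * p.1 (Y w)) (fun w => C * `|Y w|)).
  - by move=> n; apply: measurable_funM => //; apply: measurable_contY (C1b_continuous (hC n)).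
  - by move=> w; apply: cvgM; [exact: cvg_cst|exact: h1].
  - by apply: integZ; exact: integ_absY.
  - by move=> n w; rewrite normrM mulrC ler_wpM2r// (C1b_le (hC n)).
have [_ c2] : integ P (fun w => p.2 (Y w)) /\
    Ex (p_ n).2 @[n --> \oo] --> Ex p.2.
  apply: (@integ_dct _ _ _ P (fun n w => (p_ n).2 (Y w)) _ (fun w => C)).
  - by move=> n; apply: measurable_contY (C1b_dcontinuous (hC n)).
  - by move=> w; exact: h2.
  - exact: integ_cst.
  - by move=> n w; exact: (C1b_dle (hC n)).
have c3 z : jump (p_ n).1 z @[n --> \oo] --> jump p.1 z.
  apply: (proj2 (@integ_dct _ _ _ P (fun n w => (p_ n).1 (Y w + z) - (p_ n).1 (Y w))
    (fun w => p.1 (Y w + z) - p.1 (Y w)) (fun w => C * `|z|) _ _ _ _)).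
  - move=> n; apply: integ_measurable; have ln := C1b_lipschitz (hC n).
    by apply: integB; [exact: integ_lip ln|exact: integ_lip0 ln].
  - by move=> w; apply: cvgB; exact: h1.
  - exact: integ_cst.
  - by move=> n w; rewrite (le_trans (C1b_lip _ _ (hC n)))// addrAC subrr add0r.
have [_ c4] : integ nu (fun x => y x * jump p.1 (y x)) /\
    \int[nu]_x (y x * jump (p_ n).1 (y x)) @[n --> \oo] -->
    \int[nu]_x (y x * jump p.1 (y x)).
  apply: (@integ_dct _ _ _ nu (fun n x => y x * jump (p_ n).1 (y x)) _
    (fun x => C * y x ^+ 2)).
  - by move=> n; exact: measurable_yjump (C1b_lipschitz (hC n)).
  - by move=> x; apply: cvgM; [exact: cvg_cst|exact: c3].
  - exact: integZ.
  - by move=> n x; exact: yjump_le (C1b_lipschitz (hC n)).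
have c5 : q * Ex (p_ n).2 + \int[nu]_x (y x * jump (p_ n).1 (y x)) @[n --> \oo]
    --> q * Ex p.2 + \int[nu]_x (y x * jump p.1 (y x)).
  by apply: cvgD => //; apply: cvgM; [exact: cvg_cst|exact: c2].
rewrite /stein -(cvg_lim _ c1)// -(cvg_lim _ c5)//; congr (lim (_ @ \oo)).
by apply/funext => n; exact: hs.
Qed.

Hypotheses (hcos : forall v, stein (jcos v)) (hsin : forall v, stein (jsin v)).

Definition stein_trig p := bounded_jet p /\
  forall v, stein (jmul p (jcos v)) /\ stein (jmul p (jsin v)).

(* The multipliers of [stein_trig] form an algebra containing the trigonometric
   functions and closed under bounded pointwise limits. *)
Definition stein_mult p := bounded_jet p /\
  forall s, stein_trig s -> stein_trig (jmul s p).

Lemma jmulA p s t : jmul (jmul p s) t = jmul p (jmul s t).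
Proof. by congr pair; apply/funext => r /=; ring. Qed.

Lemma jmulDr p s t : jmul p (jadd s t) = jadd (jmul p s) (jmul p t).
Proof. by congr pair; apply/funext => r /=; ring. Qed.

Lemma jmulDl p s t : jmul (jadd s t) p = jadd (jmul s p) (jmul t p).
Proof. by congr pair; apply/funext => r /=; ring. Qed.

Lemma jmulZr k p s : jmul p (jscale k s) = jscale k (jmul p s).
Proof. by congr pair; apply/funext => r /=; ring. Qed.

Lemma jmulZl k p s : jmul (jscale k p) s = jscale k (jmul p s).
Proof. by congr pair; apply/funext => r /=; ring. Qed.

Lemma jmul1 p : jmul p (jone R) = p.
Proof.
case: p => f g; rewrite /jmul /=; congr pair; apply/funext => r /=.
  by rewrite mulr1.
by rewrite mulr1 mulr0 addr0.
Qed.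

Lemma jmul1l p : jmul (jone R) p = p.
Proof.
case: p => f g; rewrite /jmul /=; congr pair; apply/funext => r /=.
  by rewrite mul1r.
by rewrite mul1r mul0r add0r.
Qed.

Lemma jsincos (u v : R) : jmul (jsin u) (jcos v) =
  jscale 2^-1 (jadd (jsin (u + v)) (jsin (u + - v))).
Proof.
by congr pair; apply/funext => r /=;
  rewrite !mulrDl !mulNr !(cosD, sinD, cosN, sinN); field.
Qed.

Lemma jsinsin (u v : R) : jmul (jsin u) (jsin v) =
  jscale 2^-1 (jadd (jcos (u + - v)) (jscale (-1) (jcos (u + v)))).
Proof.
by congr pair; apply/funext => r /=;
  rewrite !mulrDl !mulNr !(cosD, sinD, cosN, sinN); field.
Qed.

Lemma stein_add p s : bounded_jet p -> bounded_jet s ->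
  stein p -> stein s -> stein (jadd p s).
Proof. by move=> [C hC] [D hD]; apply: steinD hC hD. Qed.

Lemma stein_scale k p : bounded_jet p -> stein p -> stein (jscale k p).
Proof. by move=> [C hC]; apply: steinZ hC. Qed.

Lemma bounded_jetM p s : bounded_jet p -> bounded_jet s ->
  bounded_jet (jmul p s).
Proof. by move=> [C hC] [D hD]; eexists; exact: C1b_mul hC hD. Qed.

Lemma bounded_jetD p s : bounded_jet p -> bounded_jet s ->
  bounded_jet (jadd p s).
Proof. by move=> [C hC] [D hD]; eexists; exact: C1b_add hC hD. Qed.

Lemma bounded_jetZ k p : bounded_jet p -> bounded_jet (jscale k p).
Proof. by move=> [C hC]; eexists; exact: C1b_scale hC. Qed.

Lemma bounded_jcos v : bounded_jet (@jcos R v).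
Proof. by eexists; exact: C1b_cos. Qed.

Lemma bounded_jsin v : bounded_jet (@jsin R v).
Proof. by eexists; exact: C1b_sin. Qed.

Lemma stein_trig_one : stein_trig (jone R).
Proof.
split; first by eexists; exact: C1b_one.
by move=> v; rewrite !jmul1l.
Qed.

Lemma stein_trig_stein p : stein_trig p -> stein p.
Proof.
move=> [_ /(_ 0) [+ _]]; rewrite (_ : jcos 0 = jone R) ?jmul1//.
by congr pair; apply/funext => r /=; rewrite ?mul0r ?cos0 ?oppr0.
Qed.

Lemma stein_mult_stein p : stein_mult p -> stein p.
Proof.
by move=> [_ /(_ _ stein_trig_one)]; rewrite jmul1l; exact: stein_trig_stein.
Qed.

Lemma stein_mult_one : stein_mult (jone R).
Proof. by split; [eexists; exact: C1b_one|move=> s; rewrite jmul1]. Qed.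

Lemma stein_mult_mul p s : stein_mult p -> stein_mult s -> stein_mult (jmul p s).
Proof.
move=> [bp hp] [bs hs]; split; first exact: bounded_jetM.
by move=> t /hp/hs; rewrite jmulA.
Qed.

Lemma stein_trig_add p s : stein_trig p -> stein_trig s -> stein_trig (jadd p s).
Proof.
move=> [bp hp] [bs hs]; split; first exact: bounded_jetD.
move=> v; have [p1 p2] := hp v; have [s1 s2] := hs v.
rewrite !jmulDl; split.
  exact: stein_add (bounded_jetM bp (bounded_jcos v)) (bounded_jetM bs (bounded_jcos v)) p1 s1.
exact: stein_add (bounded_jetM bp (bounded_jsin v)) (bounded_jetM bs (bounded_jsin v)) p2 s2.
Qed.

Lemma stein_trig_scale k p : stein_trig p -> stein_trig (jscale k p).
Proof.
move=> [bp hp]; split; first exact: bounded_jetZ.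
move=> v; have [p1 p2] := hp v.
rewrite !jmulZl; split.
  exact: stein_scale (bounded_jetM bp (bounded_jcos v)) p1.
exact: stein_scale (bounded_jetM bp (bounded_jsin v)) p2.
Qed.

Lemma stein_mult_add p s : stein_mult p -> stein_mult s -> stein_mult (jadd p s).
Proof.
move=> [bp hp] [bs hs]; split; first exact: bounded_jetD.
by move=> t ht; rewrite jmulDr; apply: stein_trig_add; [exact: hp|exact: hs].
Qed.

Lemma stein_mult_scale k p : stein_mult p -> stein_mult (jscale k p).
Proof.
move=> [bp hp]; split; first exact: bounded_jetZ.
by move=> t ht; rewrite jmulZr; apply: stein_trig_scale; exact: hp.
Qed.

Lemma stein_mult_sin u : stein_mult (jsin u).
Proof.
split; first exact: bounded_jsin.
move=> s [bs hs]; split; first exact: bounded_jetM bs (bounded_jsin u).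
move=> v; have [a1 a2] := hs (u + v); have [b1 b2] := hs (u + - v).
have bc w := bounded_jetM bs (bounded_jcos w); have bn w := bounded_jetM bs (bounded_jsin w).
rewrite !jmulA jsincos jsinsin !jmulZr !jmulDr !jmulZr; split.
  exact: stein_scale (bounded_jetD (bn _) (bn _)) (stein_add (bn _) (bn _) a2 b2).
apply: stein_scale (bounded_jetD (bc _) (bounded_jetZ _ (bc _))) _.
exact: stein_add (bc _) (bounded_jetZ _ (bc _)) b1 (stein_scale _ (bc _) a1).
Qed.

Lemma stein_mult_lim C (p_ : (jet R)^nat) p : (forall n, C1b C (p_ n)) ->
  (forall r, (p_ n).1 r @[n --> \oo] --> p.1 r) ->
  (forall r, (p_ n).2 r @[n --> \oo] --> p.2 r) ->
  bounded_jet p -> (forall n, stein_mult (p_ n)) -> stein_mult p.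
Proof.
move=> hC h1 h2 bp hm; split; first exact: bp.
move=> s [[D bs] hs]; split; first exact: bounded_jetM (ex_intro _ D bs) bp.
have key t : bounded_jet t -> (forall n, stein (jmul (jmul s (p_ n)) t)) ->
    stein (jmul (jmul s p) t).
  move=> [E bt] hS.
  apply: (@stein_lim (2 * (2 * (D * C) * E))
    (fun n => jmul (jmul s (p_ n)) t) _ _ _ _ hS).
  - by move=> n; apply: C1b_mul bt; exact: C1b_mul.
  - move=> r; apply: cvgM; last exact: cvg_cst.
    by apply: cvgM; [exact: cvg_cst|exact: h1].
  - move=> r; apply: cvgD; last first.
      apply: cvgM; last exact: cvg_cst.
      by apply: cvgM; [exact: cvg_cst|exact: h1].
    apply: cvgM; last exact: cvg_cst.
    by apply: cvgD; apply: cvgM; [exact: cvg_cst|exact: h1|exact: cvg_cst|exact: h2].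
have hst n : stein_trig (jmul s (p_ n)).
  by apply: (proj2 (hm n)); split; [exists D|exact: hs].
move=> v; split; apply: key.
- exact: bounded_jcos.
- by move=> n; have [] := proj2 (hst n) v.
- exact: bounded_jsin.
- by move=> n; have [] := proj2 (hst n) v.
Qed.

Lemma stein_mult_exp p : stein_mult p -> stein_mult (jexp p).
Proof.
move=> hp; have [C hC] := proj1 hp.
apply: (@stein_mult_lim _ (jexp_sum p)).
- by move=> n; exact: C1b_exp_sum hC.
- exact: cvg_jexp_sum1.
- exact: cvg_jexp_sum2.
- by eexists; exact: C1b_exp hC.
- elim=> [|n IH] /=; first exact: stein_mult_scale stein_mult_one.
  apply: (stein_mult_add IH); apply: stein_mult_scale.
  by elim: n {IH} => [|n IH] /=; [exact: stein_mult_one|exact: stein_mult_mul].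
Qed.

Lemma stein_mult_wave n : stein_mult (jwave R n).
Proof. by apply: stein_mult_scale; exact: stein_mult_sin. Qed.

Lemma stein_unwave C p : C1b C p ->
  (forall n, stein (fun r => p.1 ((jwave R n).1 r),
    fun r => (jwave R n).2 r * p.2 ((jwave R n).1 r))) -> stein p.
Proof.
move=> hC hS; have c1 := C1b_continuous hC; have [p1 p2 p3 p4] := hC.
apply: (@stein_lim C _ _ _ _ _ hS).
- move=> n; split => [r|r|r|r] /=.
  + exact: p1.
  + rewrite normrM -[leRHS]mul1r ler_pM//.
    by rewrite -[n.+1%:R * _]/((jwave R n).2 r) jwave2 cos_max.
  + have [D hD] := bounded_jwave R n; have hd := C1b_derive hD r.
    have hp := p3 ((jwave R n).1 r).
    by rewrite mulrC; exact: is_derive1_comp.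
  + have [D hD] := bounded_jwave R n.
    apply: cvgM; first exact: (C1b_dcontinuous hD).
    apply: (@continuous_comp _ _ _ (jwave R n).1 p.2); last exact: p4.
    exact: (C1b_continuous hD).
- move=> r; apply: continuous_cvg; first exact: c1.
  exact: cvg_jwave1.
- move=> r; rewrite -[p.2 r]mul1r; apply: cvgM; first exact: cvg_jwave2.
  by apply: continuous_cvg; [exact: p4|exact: cvg_jwave1].
Qed.

Hypothesis q0 : 0 <= q.

Lemma stein_wave_exp n (s eta : R) :
  stein_mult (jexp (jscale s (jwave R n))) /\
  stein_mult (jexp (jscale (- eta) (jexp (jscale s (jwave R n))))).
Proof.
have h := stein_mult_exp (stein_mult_scale s (stein_mult_wave n)).
by split; [exact: h|exact: stein_mult_exp (stein_mult_scale _ h)].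
Qed.

Lemma stein_jdamped (eta s : R) : 0 < eta -> stein (jdamped eta s).
Proof.
move=> e0; apply: (stein_unwave (C1b_jdamped s e0)) => n.
have [h1 h2] := stein_wave_exp n s eta.
rewrite (_ : (_, _) = jmul (jexp (jscale s (jwave R n)))
   (jexp (jscale (- eta) (jexp (jscale s (jwave R n)))))).
  exact: stein_mult_stein (stein_mult_mul h1 h2).
by congr pair; apply/funext => r /=; rewrite !mulNr ?mul1r //; ring.
Qed.

Lemma stein_jsatur (eta s : R) : 0 < eta -> stein (jsatur eta s).
Proof.
move=> e0; apply: (stein_unwave (C1b_jsatur s e0)) => n.
have [_ h2] := stein_wave_exp n s eta.
rewrite (_ : (_, _) = jscale eta^-1 (jadd (jone R) (jscale (-1)
   (jexp (jscale (- eta) (jexp (jscale s (jwave R n)))))))).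
  apply: stein_mult_stein; apply: stein_mult_scale.
  exact: stein_mult_add stein_mult_one (stein_mult_scale _ h2).
have n0 : eta != 0 by rewrite gt_eqF.
have m0 : 1 + n%:R != 0 :> R by rewrite addrC natr1 pnatr_eq0.
by congr pair; apply/funext => r /=; rewrite !mulNr; field; rewrite ?m0.
Qed.

Lemma Ex_id : Ex id = 0.
Proof.
have := stein_mult_stein stein_mult_one.
rewrite /stein /= Ex_cst mulr0 add0r.
have jz z : jump (fun=> 1) z = 0 by rewrite /jump subrr Ex_cst.
under [X in _ = X -> _]eq_Rintegral do rewrite jz mulr0.
rewrite Rintegral_cst// mul0r => h; rewrite -[RHS]h.
by apply: eq_Rintegral => w _; rewrite mulr1.
Qed.

Lemma stein_variance : Ex (fun r => r ^+ 2) = q + \int[nu]_x y x ^+ 2.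
Proof.
have Sw n := stein_mult_stein (stein_mult_wave n).
have wl n : lipschitz_by 1 (jwave R n).1.
  by move=> a b; rewrite mul1r jwave_lip.
have [_ c1] : integ P (fun w => Y w ^+ 2) /\
    Ex (fun r => r * (jwave R n).1 r) @[n --> \oo] --> Ex (fun r => r ^+ 2).
  apply: (@integ_dct _ _ _ P (fun n w => Y w * (jwave R n).1 (Y w))
    (fun w => Y w ^+ 2) (fun w => Y w ^+ 2)) => //.
  - move=> n; apply: measurable_funM => //.
    exact: (measurable_contY (lipschitz_by_cont (wl n))).
  - by move=> w; rewrite expr2; apply: cvgM; [exact: cvg_cst|exact: cvg_jwave1].
  - move=> n w; rewrite normrM -real_normK ?num_real// expr2.
    by rewrite ler_wpM2l// jwave_le.
have [_ c2] : integ P (fun w => 1) /\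
    Ex (jwave R n).2 @[n --> \oo] --> Ex (fun=> 1).
  apply: (@integ_dct _ _ _ P (fun n w => (jwave R n).2 (Y w)) _ (fun w => 1)).
  - move=> n; have [C hC] := bounded_jwave R n.
    exact: (measurable_contY (C1b_dcontinuous hC)).
  - by move=> w; exact: cvg_jwave2.
  - exact: integ_cst.
  - by move=> n w; rewrite jwave2 cos_max.
have c3 z : jump (jwave R n).1 z @[n --> \oo] --> z.
  rewrite -[X in _ --> X]Ex_cst.
  apply: (proj2 (@integ_dct _ _ _ P
    (fun n w => (jwave R n).1 (Y w + z) - (jwave R n).1 (Y w))
    (fun w => z) (fun w => `|z|) _ _ _ _)).
  - move=> n; apply: integ_measurable.
    by apply: integB; [exact: (integ_lip _ (wl n))|
      exact: (integ_lip0 (wl n))].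
  - move=> w; rewrite -{2}(addKr (Y w) z) [- _ + _]addrC.
    by apply: cvgB; exact: cvg_jwave1.
  - exact: integ_cst.
  - by move=> n w; rewrite (le_trans (jwave_lip _ _ _))// addrAC subrr add0r.
have [_ c4] : integ nu (fun x => y x ^+ 2) /\
    \int[nu]_x (y x * jump (jwave R n).1 (y x)) @[n --> \oo] -->
    \int[nu]_x y x ^+ 2.
  apply: (@integ_dct _ _ _ nu (fun n x => y x * jump (jwave R n).1 (y x)) _
    (fun x => y x ^+ 2)) => //.
  - by move=> n; exact: (measurable_yjump (wl n)).
  - by move=> x; rewrite expr2; apply: cvgM; [exact: cvg_cst|exact: c3].
  - by move=> n x; have := yjump_le x (wl n); rewrite mul1r.
have c5 : q * Ex (jwave R n).2 + \int[nu]_x (y x * jump (jwave R n).1 (y x))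
    @[n --> \oo] --> q + \int[nu]_x y x ^+ 2.
  rewrite -[q in X in _ --> X]mulr1 -[X in q * X]Ex_cst.
  by apply: cvgD => //; apply: cvgM; [exact: cvg_cst|exact: c2].
rewrite -(cvg_lim _ c1)// -(cvg_lim _ c5)//; congr (lim (_ @ \oo)).
by apply/funext => n; exact: Sw.
Qed.

Let V := Ex (fun r => r ^+ 2).

Lemma stein_jdamped_le (eta s : R) : 0 < eta -> 0 <= s -> nu [set x | 0 < y x] = 0%E ->
  Ex (fun r => r * (jdamped eta s).1 r) <= s * V * Ex (jdamped eta s).1.
Proof.
move=> e0 s0 N0; have hC := C1b_jdamped s e0; have hl := C1b_lipschitz hC.
have h1 := integ_jet1 hC; have h2 := integ_jet2 hC.
have hS := stein_jdamped s e0; rewrite /stein in hS.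
rewrite hS /V stein_variance mulrDr mulrDl lerD//.
  rewrite [s * q]mulrC -mulrA ler_wpM2l// -ExZ//; apply: le_Ex => //.
    exact: integZ.
  by move=> r; exact: jdamped2_le.
rewrite -(RintegralZl _ measurableT y2) -(RintegralZr _ measurableT (integZ s y2)).
apply: (le_Rintegral_ae _ N0).
- exact: measurable_gt.
- exact: (integ_yjump hl).
- rewrite (_ : (fun x => _) = (fun x => s * Ex (jdamped eta s).1 * y x ^+ 2)).
    exact: integZ.
  by apply/funext => x; ring.
move=> x /negP; rewrite -leNgt => x0.
have hj : integ P (fun w => (jdamped eta s).1 (Y w + y x) - (jdamped eta s).1 (Y w)).
  by apply: integB; [exact: (integ_lip _ hl)|].
rewrite /jump -(@ExZ _ (fun r => (jdamped eta s).1 (r + y x) - (jdamped eta s).1 r) hj).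
rewrite -(@ExZ _ (jdamped eta s).1 h1).
apply: le_Ex; [exact: integZ hj|exact: integZ h1|].
by move=> r; exact: jdamped_jump_le.
Qed.

(* Gronwall: the s-derivative of E (jsatur eta s)(Y) is E[Y (jdamped eta s)(Y)]. *)
Lemma Ex_jsatur_le (eta s : R) : 0 < eta -> 0 <= s -> nu [set x | 0 < y x] = 0%E ->
  Ex (jsatur eta s).1 <= expR (V * s ^+ 2 / 2).
Proof.
move=> e0 s0 N0.
pose m u := Ex (jsatur eta u).1.
have hD (u : R) : is_derive u 1 m (Ex (fun r => r * (jdamped eta u).1 r)).
  apply: (@is_derive_Rintegral _ _ _ P (`|u| + 1)
    (fun u w => (jsatur eta u).1 (Y w)) (fun u w => Y w * (jdamped eta u).1 (Y w))
    (fun w => eta^-1 * `|Y w|)).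
  - by move=> v; exact: (integ_jet1 (C1b_jsatur v e0)).
  - by apply: integZ; exact: integ_absY.
  - move=> v w /=; have h := is_derive_exp_expM eta (Y w) v.
    have n0 : eta != 0 by rewrite gt_eqF.
    under eq_fun do rewrite mulrC [_ * Y w]mulrC.
    apply: is_derive_eq.
    by rewrite /GRing.scale /= [v * Y w]mulrC; field.
  - move=> v w _; rewrite normrM mulrC ler_wpM2r// ger0_norm ?jdamped_ge0//.
    exact: jdamped_le_inv.
  - by rewrite ltrDl.
pose k u := m u * expR (- (V * u ^+ 2 / 2)).
have hk (u : R) : is_derive u 1 k
    ((Ex (fun r => r * (jdamped eta u).1 r) - u * V * m u) * expR (- (V * u ^+ 2 / 2))).
  have h := hD u; apply: is_derive_eq.
  by rewrite /GRing.scale /=; field.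
have V0 : 0 <= V by apply: Rintegral_ge0 => w _; exact: sqr_ge0.
have k1 : k s <= k 0.
  apply: (@ler0_derive1_le_cc _ k 0 s); rewrite ?in_itv/= ?lexx ?s0//.
  - move=> u; rewrite in_itv/= => /andP[/ltW u0 _].
    rewrite derive1E; have [_ ->] := hk u.
    rewrite mulr_le0_ge0 ?expR_ge0// subr_le0.
    apply: (le_trans (stein_jdamped_le e0 u0 N0)).
    rewrite ler_wpM2l ?mulr_ge0//; apply: le_Ex.
    + exact: (integ_jet1 (C1b_jdamped u e0)).
    + exact: (integ_jet1 (C1b_jsatur u e0)).
    + by move=> r; exact: jdamped_le_satur.
  - exact: continuous_subspaceT (is_derive_continuous hk).
have k0 : k 0 <= 1.
  rewrite /k expr0n/= mulr0 mul0r oppr0 expR0 mulr1 /m -(Ex_cst 1).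
  apply: le_Ex; [exact: (integ_jet1 (C1b_jsatur 0 e0))|exact: integ_cst|].
  by move=> r; rewrite (le_trans (jsatur_le_exp _ _ e0))// mul0r expR0.
have := le_trans k1 k0; rewrite /k expRN ler_pdivrMr ?expR_gt0// mul1r.
exact.
Qed.

Lemma exp_moment_le (s : R) : 0 <= s -> nu [set x | 0 < y x] = 0%E ->
  integ P (fun w => expR (s * Y w)) /\
  Ex (fun r => expR (s * r)) <= expR (V * s ^+ 2 / 2).
Proof.
move=> s0 N0; have e0 n : 0 < n.+1%:R^-1 :> R by rewrite invr_gt0.
apply: (@integ_fatou _ _ _ P (fun n w => (jsatur n.+1%:R^-1 s).1 (Y w))).
- by move=> n; exact: (integ_jet1 (C1b_jsatur s (e0 n))).
- by move=> n w; exact: jsatur_ge0.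
- by move=> w; exact: cvg_jsatur.
- by move=> n; exact: Ex_jsatur_le.
Qed.

Lemma exp_outgrows_quadratic (k eps W : R) : 0 < k -> 0 < eps -> 0 <= W ->
  exists2 s, 0 <= s & 1 + W * (s + 2) ^+ 2 / 2 <= k * (expR (s * eps) - 1) / 2.
Proof.
move=> k0 e0 W0.
pose d := k * eps ^+ 3 / 6.
have d0 : 0 < d by rewrite /d divr_gt0// mulr_gt0// exprn_gt0.
pose s := 2 + (2 + 4 * W) / d.
have s2 : 2 <= s by rewrite /s lerDl divr_ge0 ?(ltW d0)//; lra.
exists s; first by lra.
have ds : 2 + 4 * W <= d * s.
  rewrite /s mulrDr [d * (_ / _)]mulrC mulfVK ?gt_eqF//.
  by rewrite lerDr mulr_ge0 ?(ltW d0).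
have se0 : 0 <= s * eps by rewrite mulr_ge0 ?(ltW e0)//; lra.
have h := expR_ge1Dxn 2 se0.
have h6 : 3`!%:R = 6 :> R by [].
rewrite h6 in h.
have h7 : d * s ^+ 3 <= k * (expR (s * eps) - 1).
  rewrite (_ : d * s ^+ 3 = k * ((s * eps) ^+ 3 / 6)); last by rewrite /d; field.
  by rewrite ler_wpM2l ?(ltW k0)//; lra.
have h8 : (2 + 4 * W) * s ^+ 2 <= d * s ^+ 3.
  by rewrite [s ^+ 3]exprS mulrA ler_wpM2r ?sqr_ge0.
have h9 : 2 + W * (s + 2) ^+ 2 <= (2 + 4 * W) * s ^+ 2.
  have : W * (s + 2) ^+ 2 <= W * (4 * s ^+ 2) by rewrite ler_wpM2l//; nra.
  have : 1 <= s ^+ 2 by nra.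
  by lra.
by lra.
Qed.

(* Dropping all jumps below eps, the Stein identity gives
   E[Y f(Y)] >= kap E[f(Y + eps) - f(Y)] for increasing f.  With f close to
   e^(s r) and E[Y f(Y)] split at the level A, this forces
   A E e^(sY) <= e^(-A) E e^((s+2)Y), absurd when A outgrows W (s+2)^2 / 2. *)
Lemma no_positive_jump W eps : 0 < eps -> 0 <= W ->
  (forall s : R, 0 <= s -> integ P (fun w => expR (s * Y w)) /\
     Ex (fun r => expR (s * r)) <= expR (W * s ^+ 2 / 2)) ->
  nu [set x | eps < y x] = 0%E.
Proof.
move=> ep0 W0 hexp; set N := [set x | eps < y x].
have mN : measurable N by exact: measurable_gt.
have iN : integ nu (\1_N : T -> R).
  apply: (@le_integ _ _ _ _ _ (fun x => (eps ^+ 2)^-1 * y x ^+ 2)); last exact: integZ.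
    exact: measurable_indic.
  move=> x; rewrite indicE; have [xN|xN] := boolP (x \in N); last first.
    by rewrite normr0 mulr_ge0 ?invr_ge0 ?sqr_ge0.
  rewrite normr1 ler_pdivlMl ?exprn_gt0// mulr1.
  by move: xN; rewrite inE /N /= => h; rewrite ler_pXn2r ?nnegrE ?ltW// (lt_trans ep0).
pose kap := eps * \int[nu]_x \1_N x.
have intN : (\int[nu]_x (\1_N x)%:E)%E = nu N.
  by rewrite integral_indic// setIT.
have nuE : nu N = (\int[nu]_x \1_N x)%:E.
  rewrite -intN /Rintegral fineK//; exact: integrable_fin_num iN.
have kap0 : 0 <= kap.
  by rewrite mulr_ge0 ?(ltW ep0)//; apply: Rintegral_ge0 => x _; rewrite indicE.
have [k0|kapn0] := eqVneq kap 0.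
  move/eqP: k0; rewrite /kap mulf_eq0 gt_eqF//= => /eqP h.
  by rewrite nuE h.
have kgt0 : 0 < kap by rewrite lt_neqAle eq_sym kapn0.
exfalso.
have [s s0 hs] := exp_outgrows_quadratic kgt0 ep0 W0.
set A := kap * (expR (s * eps) - 1) / 2 in hs.
have A0 : 0 <= A.
  by apply: le_trans hs; rewrite addr_ge0// divr_ge0// mulr_ge0// sqr_ge0.
pose m u := Ex (fun r => expR (u * r)).
have [is_ _] := hexp s s0.
have s20 : 0 <= s + 2 by rewrite addr_ge0.
have [is2 ms2] := hexp (s + 2) s20.
have key n : kap * (Ex (fun r => (jsatur n.+1%:R^-1 s).1 (r + eps)) -
    Ex (jsatur n.+1%:R^-1 s).1) <=
    A * Ex (jsatur n.+1%:R^-1 s).1 + expR (- A) * m (s + 2).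
  have e0 : 0 < n.+1%:R^-1 :> R by rewrite invr_gt0.
  set F := jsatur _ s; have hC := C1b_jsatur s e0; have hl := C1b_lipschitz hC.
  have mono := jsatur_mono e0 s0.
  apply: (@le_trans _ _ (Ex (fun r => r * F.1 r))).
    have hS := stein_jsatur s e0; rewrite /stein -/F in hS.
    rewrite hS -[leLHS]add0r lerD//.
      rewrite mulr_ge0//; apply: Rintegral_ge0 => w _.
      by rewrite /F /= mulr_ge0// mulr_ge0 ?expR_ge0.
    rewrite -(jumpE _ hl) /kap mulrAC -RintegralZl//.
    apply: le_Rintegral => //; [exact: integZ|exact: (integ_yjump hl)|].
    have jpos z : 0 <= z -> 0 <= jump F.1 z.
      move=> z0; apply: Rintegral_ge0 => w _; rewrite subr_ge0.
      by apply: mono; rewrite lerDl.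
    have jneg z : z <= 0 -> jump F.1 z <= 0.
      move=> z0; rewrite -oppr_ge0 (jumpE _ hl) opprB subr_ge0.
      apply: le_Ex; [exact: (integ_lip _ hl)|exact: (integ_lip0 hl)|].
      by move=> r; apply: mono; rewrite gerDl.
    move=> x _; rewrite indicE; have [xN|xN] := boolP (x \in N); last first.
      rewrite mulr0; have [h|/ltW h] := leP 0 (y x).
        by rewrite mulr_ge0// jpos.
      by rewrite mulr_le0// jneg.
    move: xN; rewrite inE /N /= => h; rewrite mulr1.
    apply: ler_pM (ltW ep0) (jpos _ (ltW ep0)) (ltW h) _.
    rewrite !(jumpE _ hl) lerD2r; apply: le_Ex.
    - exact: (integ_lip _ hl).
    - exact: (integ_lip _ hl).
    - by move=> r; apply: mono; rewrite lerD2l ltW.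
  have i1 := integ_jet1 hC.
  rewrite -ExZ// -ExZ// -ExD//; [|exact: integZ|exact: integZ].
  apply: le_Ex.
  - exact: (integ_Yjet hC).
  - by apply: integD; exact: integZ.
  move=> r; have F0 : 0 <= F.1 r by exact: jsatur_ge0.
  have [rA|/ltW Ar] := leP r A.
    by rewrite -[leLHS]addr0 lerD ?mulr_ge0 ?expR_ge0// ler_wpM2r.
  rewrite -[leLHS]add0r; apply: lerD; first exact: mulr_ge0 A0 F0.
  apply: (@le_trans _ _ (expR r * expR (s * r))).
    apply: ler_pM; [exact: le_trans A0 Ar|exact: F0| |exact: jsatur_le_exp].
    by rewrite (le_trans _ (expR_ge1Dx r))// lerDr.
  by rewrite -!expRD ler_expR; nra.
have lim1 z : 0 <= z -> Ex (fun r => (jsatur n.+1%:R^-1 s).1 (r + z)) @[n --> \oo] -->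
    expR (s * z) * m s.
  move=> z0; rewrite /m -ExZ//.
  apply: (proj2 (@integ_dct _ _ _ P (fun n w => (jsatur n.+1%:R^-1 s).1 (Y w + z))
    (fun w => expR (s * z) * expR (s * Y w)) (fun w => expR (s * z) * expR (s * Y w))
    _ _ _ _)).
  - move=> n; have e0 : 0 < n.+1%:R^-1 :> R by rewrite invr_gt0.
    apply: integ_measurable.
    exact: (integ_lip _ (C1b_lipschitz (C1b_jsatur s e0))).
  - by move=> w; rewrite -expRD -mulrDr [z + _]addrC; exact: cvg_jsatur.
  - exact: integZ.
  - move=> n w; have e0 : 0 < n.+1%:R^-1 :> R by rewrite invr_gt0.
    rewrite ger0_norm ?jsatur_ge0// -expRD -mulrDr [z + _]addrC.
    exact: jsatur_le_exp.
have lim0 : Ex (jsatur n.+1%:R^-1 s).1 @[n --> \oo] --> m s.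
  have h := lim1 0 (lexx 0); rewrite mulr0 expR0 mul1r in h.
  have -> : (fun n => Ex (jsatur n.+1%:R^-1 s).1) =
      (fun n => Ex (fun r => (jsatur n.+1%:R^-1 s).1 (r + 0))); last exact: h.
  by apply/funext => n; apply: eq_Rintegral => w _; rewrite addr0.
have fin : kap * (expR (s * eps) * m s - m s) <= A * m s + expR (- A) * m (s + 2).
  have c1 : kap * (Ex (fun r => (jsatur n.+1%:R^-1 s).1 (r + eps)) -
      Ex (jsatur n.+1%:R^-1 s).1) @[n --> \oo] --> kap * (expR (s * eps) * m s - m s).
    by apply: cvgM; [exact: cvg_cst|apply: cvgB; [exact: lim1 (ltW ep0)|exact: lim0]].
  have c2 : A * Ex (jsatur n.+1%:R^-1 s).1 + expR (- A) * m (s + 2) @[n --> \oo]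
      --> A * m s + expR (- A) * m (s + 2).
    by apply: cvgD; [apply: cvgM; [exact: cvg_cst|exact: lim0]|exact: cvg_cst].
  exact: (ler_cvg_to c1 c2 (nearW _ key)).
have m1 : 1 <= m s.
  apply: (@le_trans _ _ (Ex (fun r => 1 + s * r))).
    rewrite (@ExD (fun=> 1) (fun r => s * r)) ?Ex_cst; last first.
    - by apply: integZ; exact: integ_Y.
    - exact: integ_cst.
    by rewrite ExZ; [rewrite Ex_id mulr0 addr0|exact: integ_Y].
  apply: le_Ex => //.
    by apply: integD; [exact: integ_cst|apply: integZ; exact: integ_Y].
  by move=> r; exact: expR_ge1Dx.
have Am : A * m s <= expR (- A) * m (s + 2).
  have e : kap * (expR (s * eps) * m s - m s) = A * m s + A * m s.
    by rewrite /A; field.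
  by rewrite e lerD2l in fin.
have bound : expR (- A) * m (s + 2) <= expR (-1).
  apply: (@le_trans _ _ (expR (- A) * expR (W * (s + 2) ^+ 2 / 2))).
    by rewrite ler_wpM2l ?expR_ge0.
  by rewrite -expRD ler_expR addrC lerBlDr -lerBlDl opprK addrC.
have A1 : 1 <= A.
  by apply: le_trans hs; rewrite lerDl divr_ge0// mulr_ge0// sqr_ge0.
have e1 : expR (-1) < 1 :> R by rewrite expR_lt1 ltrN10.
have := le_lt_trans (le_trans (mulr_ege1 A1 m1) (le_trans Am bound)) e1.
by rewrite ltxx.
Qed.

End stein_identity.

(** * From the Levy-Khintchine formula to the Stein identity *)

Section levy_khintchine_stein.
Context (R : realType) dO (Omega : measurableType dO) (P : probability Omega R).
Context dT (T : measurableType dT) (nu : {measure set T -> \bar R}).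
Variables (Y : Omega -> R) (y nm : T -> R) (q g K : R).
Hypotheses (mY : measurable_fun setT Y) (Y2 : integ P (fun w => Y w ^+ 2)).
Hypothesis (EY0 : Ex P Y id = 0).
Hypotheses (my : measurable_fun setT y) (mnm : measurable_fun setT nm).
Hypotheses (ynm : forall x, `|y x| <= K * nm x) (nm0 : forall x, 0 <= nm x).
Hypothesis (K0 : 0 <= K).
Hypothesis (inm : integ nu (fun x => Num.min 1 (nm x ^+ 2))).
Hypothesis (q0 : 0 <= q).

Let LKre (u : R) := - (q * u ^+ 2 / 2) + \int[nu]_x (cos (u * y x) - 1).
Let LKim (u : R) := g * u +
  \int[nu]_x (sin (u * y x) - (if nm x <= 1 then u * y x else 0)).
Let C (u : R) := Ex P Y (fun r => cos (u * r)).
Let D (u : R) := Ex P Y (fun r => sin (u * r)).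
Hypothesis (LKcos : forall u, C u = expR (LKre u) * cos (LKim u)).
Hypothesis (LKsin : forall u, D u = expR (LKre u) * sin (LKim u)).

Lemma sin_lip (a b : R) : `|sin a - sin b| <= `|a - b|.
Proof.
rewrite -[leRHS]mul1r.
exact: (is_derive_lip (fun r : R => is_derive_sin r) (@cos_max R) a b).
Qed.

Lemma cos_lip (a b : R) : `|cos a - cos b| <= `|a - b|.
Proof.
rewrite -[leRHS]mul1r.
apply: (is_derive_lip (fun r : R => is_derive_cos r) _ a b) => r.
by rewrite normrN sin_max.
Qed.

Lemma norm_sin_le (z : R) : `|sin z| <= `|z|.
Proof. by have := sin_lip z 0; rewrite sin0 !subr0. Qed.

Lemma norm_cosB1_le (z : R) : `|cos z - 1| <= `|z|.
Proof. by have := cos_lip z 0; rewrite cos0 !subr0. Qed.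

Lemma cosB1_sqr (z : R) : cos z - 1 = - (2 * sin (z / 2) ^+ 2).
Proof.
rewrite {1}(_ : z = z / 2 + z / 2); last by field.
by rewrite cosD -!expr2 cos2sin2; ring.
Qed.

Lemma norm_cosB1_le_sqr (z : R) : `|cos z - 1| <= z ^+ 2.
Proof.
rewrite cosB1_sqr normrN ger0_norm; last by rewrite mulr_ge0// sqr_ge0.
have h := norm_sin_le (z / 2).
have h2 : sin (z / 2) ^+ 2 <= (z / 2) ^+ 2.
  by rewrite -[leLHS]real_normK ?num_real// -[leRHS]real_normK ?num_real// lerXn2r ?nnegrE.
have hz := sqr_ge0 z; move: h2; rewrite expr_div_n. lra.
Qed.

Lemma norm_sinB_le_sqr (z : R) : `|sin z - z| <= z ^+ 2.
Proof.
have d (r : R) : is_derive r 1 (fun r : R => sin r - r) (cos r - 1).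
  by apply: is_derive_eq.
wlog z0 : z / 0 <= z.
  move=> h; have [|/ltW z0] := leP 0 z; first exact: h.
  have := h (- z); rewrite oppr_ge0 sinN sqrrN -opprD normrN; exact.
have [c] := MVT_segment z0 (fun x _ => d x)
  (continuous_subspaceT (is_derive_continuous d)).
rewrite in_itv/= sin0 !subr0 => /andP[c0 cz] ->.
rewrite normrM expr2 (ger0_norm z0) ler_wpM2r//.
by rewrite (le_trans (norm_cosB1_le c))// ger0_norm.
Qed.

Lemma sqr_y_le x : y x ^+ 2 <= K ^+ 2 * nm x ^+ 2.
Proof.
rewrite -exprMn -real_normK ?num_real// lerXn2r ?nnegrE//.
by rewrite mulr_ge0.
Qed.

Lemma cosB1_le_min (u : R) x :
  `|cos (u * y x) - 1| <= (2 + u ^+ 2 * K ^+ 2) * Num.min 1 (nm x ^+ 2).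
Proof.
have k0 : 0 <= u ^+ 2 * K ^+ 2 by rewrite mulr_ge0 ?sqr_ge0.
rewrite /Num.min; case: ifPn => _.
  rewrite mulr1 (le_trans (ler_normB _ _))// normr1 (@le_trans _ _ 2)//.
    by rewrite -[2]/(1 + 1) lerD2r cos_max.
  by rewrite lerDl.
rewrite (le_trans (norm_cosB1_le_sqr _))// exprMn mulrDl.
have := ler_wpM2l (sqr_ge0 u) (sqr_y_le x); have := sqr_ge0 (nm x).
by move=> h1 h2; rewrite (le_trans h2)// mulrA lerDr mulr_ge0.
Qed.

Lemma measurable_cosy (u : R) : measurable_fun setT (fun x => cos (u * y x)).
Proof.
apply: (measurableT_comp (continuous_measurable_fun (@continuous_cos R))).
exact: measurable_funM.
Qed.

Lemma measurable_siny (u : R) : measurable_fun setT (fun x => sin (u * y x)).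
Proof.
apply: (measurableT_comp (continuous_measurable_fun (@continuous_sin R))).
exact: measurable_funM.
Qed.

Lemma integ_cosB1 (u : R) : integ nu (fun x => cos (u * y x) - 1).
Proof.
apply: (le_integ _ (cosB1_le_min u)); last exact: integZ.
by apply: measurable_funB => //; exact: measurable_cosy.
Qed.

Lemma integ_cosY (u : R) : integ P (fun w => cos (u * Y w)).
Proof. exact: (integ_jet1 P mY (C1b_cos u)). Qed.

Lemma integ_sinY (u : R) : integ P (fun w => sin (u * Y w)).
Proof. exact: (integ_jet1 P mY (C1b_sin u)). Qed.

Let V := Ex P Y (fun r => r ^+ 2).

Lemma C_ge (u : R) : 1 - u ^+ 2 * V <= C u.
Proof.
rewrite /V -(Ex_cst P Y 1) -(@ExZ _ _ _ P Y (u ^+ 2) (fun r => r ^+ 2) Y2).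
rewrite -(@ExB _ _ _ P Y (fun=> 1) (fun r => u ^+ 2 * r ^+ 2)
  (integ_cst P 1) (integZ _ Y2)).
apply: le_Ex.
- by apply: integB; [exact: integ_cst|exact: integZ].
- exact: integ_cosY.
- move=> r; have := norm_cosB1_le_sqr (u * r); rewrite exprMn ler_norml.
  by move=> /andP[+ _]; lra.
Qed.

(* 1 - u^2 V <= E cos(uY) <= |E e^(iuY)|, and the modulus is at most e^(-a) with
   a the jump part of the exponent. *)
Lemma LKre_le (u : R) : u ^+ 2 * V <= 2^-1 ->
  \int[nu]_x (1 - cos (u * y x)) <= 2 * (u ^+ 2 * V).
Proof.
move=> uV; set a := \int[nu]_x _.
have a0 : 0 <= a.
  by apply: Rintegral_ge0 => x _; rewrite subr_ge0 cos_le1.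
have h : 1 - u ^+ 2 * V <= expR (- a).
  apply: (le_trans (C_ge u)); rewrite LKcos.
  apply: (@le_trans _ _ (expR (LKre u))).
    by rewrite -[leRHS]mulr1 ler_wpM2l ?expR_ge0 ?cos_le1.
  rewrite ler_expR /LKre.
  have -> : \int[nu]_x (cos (u * y x) - 1) = - a.
    rewrite /a -[RHS]mulN1r -RintegralZl//.
      by apply: eq_Rintegral => x _; ring.
    have := integZ (-1) (integ_cosB1 u); congr integ.
    by apply/funext => x; ring.
  by rewrite gerDr oppr_le0 divr_ge0// mulr_ge0// sqr_ge0.
have h2 : (1 - u ^+ 2 * V) * (1 + a) <= 1.
  apply: (@le_trans _ _ (expR (- a) * expR a)); last first.
    by rewrite -expRD addNr expR0.
  by apply: ler_pM; [lra|exact: addr_ge0|exact: h|exact: expR_ge1Dx].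
by nra.
Qed.

Lemma integ_y2 : integ nu (fun x => y x ^+ 2).
Proof.
pose f (n : nat) x := 2 * (n.+1%:R ^+ 2 * (1 - cos (n.+1%:R^-1 * y x))) : R.
have fE n x : f n x = 4 * (jwave R n).1 (y x / 2) ^+ 2.
  have := cosB1_sqr (n.+1%:R^-1 * y x) => h.
  rewrite /f /= (_ : 1 - _ = 2 * sin (n.+1%:R^-1 * y x / 2) ^+ 2); last by lra.
  by rewrite -[_ * y x / 2]mulrA; ring.
have V0 : 0 <= V by apply: Rintegral_ge0 => w _; exact: sqr_ge0.
pose M := \int[nu]_x ((2 + K ^+ 2) * Num.min 1 (nm x ^+ 2)).
have i1 u : integ nu (fun x => 1 - cos (u * y x)).
  have := integZ (-1) (integ_cosB1 u); congr integ.
  by apply/funext => x; ring.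
have M0 : 0 <= M.
  apply: Rintegral_ge0 => x _; rewrite mulr_ge0 ?addr_ge0 ?sqr_ge0//.
  by rewrite le_min ler01 sqr_ge0.
apply: (proj1 (@integ_fatou _ _ _ nu f (fun x => y x ^+ 2)
  (4 * V * (1 + M)) _ _ _ _)).
- by move=> n; apply: integZ; exact: integZ.
- by move=> n x; rewrite fE mulr_ge0// sqr_ge0.
- move=> x; rewrite (_ : f ^~ x = (fun n => 4 * (jwave R n).1 (y x / 2) ^+ 2)); last first.
    by apply/funext => n; exact: fE.
  rewrite (_ : y x ^+ 2 = 4 * (y x / 2) ^+ 2); last by field.
  apply: cvgM; first exact: cvg_cst.
  by rewrite !expr2; apply: cvgM; exact: cvg_jwave1.
move=> n; rewrite /f; set u : R := n.+1%:R^-1.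
rewrite RintegralZl//; last exact: integZ.
rewrite RintegralZl//; last exact: i1.
have n0 : 0 < n.+1%:R :> R by [].
have u0 : 0 < u by rewrite invr_gt0.
have un : n.+1%:R ^+ 2 * u ^+ 2 = 1 by rewrite -exprMn mulfV ?expr1n// gt_eqF.
have [uV|uV] := leP (u ^+ 2 * V) 2^-1.
  have h := LKre_le uV.
  have h2 : n.+1%:R ^+ 2 * \int[nu]_x (1 - cos (u * y x)) <= 2 * V.
    apply: (le_trans (ler_wpM2l (sqr_ge0 _) h)).
    by rewrite mulrCA [_ ^+ 2 * (_ * V)]mulrA un mul1r.
  by nra.
have nV : n.+1%:R ^+ 2 <= 2 * V.
  have n2 : 0 < n.+1%:R ^+ 2 :> R by rewrite exprn_gt0.
  have : n.+1%:R ^+ 2 * 2^-1 <= n.+1%:R ^+ 2 * (u ^+ 2 * V) by rewrite ler_wpM2l ?ltW.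
  by rewrite mulrA un mul1r; lra.
have aM : \int[nu]_x (1 - cos (u * y x)) <= M.
  apply: (le_Rintegral measurableT (i1 u) (integZ (2 + K ^+ 2) inm)) => x _.
  rewrite (le_trans (ler_norm _))// distrC (le_trans (cosB1_le_min u x))//.
  rewrite ler_wpM2r//; first by rewrite le_min ler01 sqr_ge0.
  rewrite lerD2l ler_piMl ?sqr_ge0//.
  by rewrite exprn_ile1 ?(ltW u0)// /u invf_le1// ler1n.
have a0 : 0 <= \int[nu]_x (1 - cos (u * y x)).
  by apply: Rintegral_ge0 => x _; rewrite subr_ge0 cos_le1.
have := ler_pM (sqr_ge0 _) a0 nV aM.
by nra.
Qed.

(* The drift once all jumps are compensated; it vanishes since Y is centered. *)
Let g' := g + \int[nu]_x (if nm x <= 1 then 0 else y x).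

Lemma integ_bigy : integ nu (fun x => if nm x <= 1 then 0 else y x).
Proof.
apply: (@le_integ _ _ _ _ _ (fun x => Num.min 1 (nm x ^+ 2) + y x ^+ 2)).
- apply: measurable_fun_ifT => //.
  by apply: measurable_fun_ler.
- move=> x; have h := sqr_ge0 (`|y x| - 1); rewrite /Num.min.
  have [n1|n1] := leP (nm x) 1.
    by rewrite normr0 addr_ge0 ?sqr_ge0//; case: ifP; rewrite ?sqr_ge0.
  case: ifPn => [_|]; last by rewrite -leNgt leNgt exprn_egt1.
  by rewrite -[y x ^+ 2]real_normK ?num_real//; nra.
- by apply: integD => //; exact: integ_y2.
Qed.

Lemma integ_sinB (u : R) : integ nu (fun x => sin (u * y x) - u * y x).
Proof.
apply: (@le_integ _ _ _ _ _ (fun x => u ^+ 2 * y x ^+ 2)); last first.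
- by apply: integZ; exact: integ_y2.
- by move=> x; rewrite -exprMn norm_sinB_le_sqr.
- by apply: measurable_funB; [exact: measurable_siny|exact: measurable_funM].
Qed.

Lemma LKimE (u : R) : LKim u = g' * u + \int[nu]_x (sin (u * y x) - u * y x).
Proof.
rewrite /LKim /g' mulrDl -addrA; congr (_ + _).
rewrite -RintegralZr//; last exact: integ_bigy.
rewrite -RintegralD//; last 2 first.
- have := integZ u integ_bigy; congr integ.
  by apply/funext => x; rewrite mulrC.
- exact: integ_sinB.
by apply: eq_Rintegral => x _; case: ifP => _; ring.
Qed.

Lemma integ_ysin (u : R) : integ nu (fun x => y x * sin (u * y x)).
Proof.
apply: (@le_integ _ _ _ _ _ (fun x => `|u| * y x ^+ 2)); last first.
- by apply: integZ; exact: integ_y2.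
- move=> x; rewrite normrM -[y x ^+ 2]real_normK ?num_real// expr2 mulrCA.
  by rewrite ler_wpM2l// -normrM norm_sin_le.
- by apply: measurable_funM => //; exact: measurable_siny.
Qed.

Lemma integ_ycosB1 (u : R) : integ nu (fun x => y x * (cos (u * y x) - 1)).
Proof.
apply: (@le_integ _ _ _ _ _ (fun x => `|u| * y x ^+ 2)); last first.
- by apply: integZ; exact: integ_y2.
- move=> x; rewrite normrM -[y x ^+ 2]real_normK ?num_real// expr2 mulrCA.
  by rewrite ler_wpM2l// -normrM norm_cosB1_le.
- apply: measurable_funM => //; apply: measurable_funB => //.
  exact: measurable_cosy.
Qed.

Let dre (u : R) := - (q * u) - \int[nu]_x (y x * sin (u * y x)).
Let dim (u : R) := g' + \int[nu]_x (y x * (cos (u * y x) - 1)).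

Lemma is_derive_sinM (a u : R) : is_derive u 1 (fun u => sin (u * a)) (a * cos (u * a)).
Proof. by apply: is_derive_eq; rewrite /GRing.scale /=; ring. Qed.

Lemma is_derive_cosM (a u : R) : is_derive u 1 (fun u => cos (u * a)) (- (a * sin (u * a))).
Proof. by apply: is_derive_eq; rewrite /GRing.scale /=; ring. Qed.

Lemma is_derive_LKre (u : R) : is_derive u 1 LKre (dre u).
Proof.
have h : is_derive u 1 (fun u => \int[nu]_x (cos (u * y x) - 1))
    (\int[nu]_x (- (y x * sin (u * y x)))).
  apply: (@is_derive_Rintegral _ _ _ nu (`|u| + 1) (fun u x => cos (u * y x) - 1)
    (fun u x => - (y x * sin (u * y x))) (fun x => (`|u| + 1) * y x ^+ 2)).
  - exact: integ_cosB1.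
  - by apply: integZ; exact: integ_y2.
  - move=> v x; have h := is_derive_cosM (y x) v.
    by apply: is_derive_eq; rewrite subr0.
  - move=> v x vM; rewrite normrN normrM -[y x ^+ 2]real_normK ?num_real// expr2 mulrCA.
    rewrite ler_wpM2l// (le_trans (norm_sin_le _))// normrM ler_wpM2r//.
    exact: ltW.
  - by rewrite ltrDl.
apply: is_derive_eq.
rewrite /dre (_ : \int[nu]_x (- (y x * sin (u * y x))) =
  - \int[nu]_x (y x * sin (u * y x))).
  by rewrite /GRing.scale /=; field.
rewrite -[RHS]mulN1r -RintegralZl//; last exact: integ_ysin.
by apply: eq_Rintegral => x _; rewrite mulN1r.
Qed.

Lemma is_derive_LKim (u : R) : is_derive u 1 LKim (dim u).
Proof.
have h : is_derive u 1 (fun u => \int[nu]_x (sin (u * y x) - u * y x))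
    (\int[nu]_x (y x * (cos (u * y x) - 1))).
  apply: (@is_derive_Rintegral _ _ _ nu (`|u| + 1) (fun u x => sin (u * y x) - u * y x)
    (fun u x => y x * (cos (u * y x) - 1)) (fun x => (`|u| + 1) * y x ^+ 2)).
  - exact: integ_sinB.
  - by apply: integZ; exact: integ_y2.
  - move=> v x; have h := is_derive_sinM (y x) v.
    by apply: is_derive_eq; rewrite /GRing.scale /=; ring.
  - move=> v x vM; rewrite normrM -[y x ^+ 2]real_normK ?num_real// expr2 mulrCA.
    rewrite ler_wpM2l// (le_trans (norm_cosB1_le _))// normrM ler_wpM2r//.
    exact: ltW.
  - by rewrite ltrDl.
rewrite (_ : LKim = fun u => g' * u + \int[nu]_x (sin (u * y x) - u * y x)); last first.
  by apply/funext => v; exact: LKimE.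
by apply: is_derive_eq; rewrite /dim /GRing.scale /= mulr1.
Qed.

Lemma is_derive_C (u : R) : is_derive u 1 C (Ex P Y (fun r => - (r * sin (u * r)))).
Proof.
apply: (@is_derive_Rintegral _ _ _ P (`|u| + 1) (fun u w => cos (u * Y w))
  (fun u w => - (Y w * sin (u * Y w))) (fun w => `|Y w|)).
- exact: integ_cosY.
- exact: integ_absY.
- by move=> v w; exact: is_derive_cosM.
- move=> v w _; rewrite normrN normrM -[leRHS]mulr1.
  by rewrite ler_wpM2l// sin_max.
- by rewrite ltrDl.
Qed.

Lemma is_derive_D (u : R) : is_derive u 1 D (Ex P Y (fun r => r * cos (u * r))).
Proof.
apply: (@is_derive_Rintegral _ _ _ P (`|u| + 1) (fun u w => sin (u * Y w))
  (fun u w => Y w * cos (u * Y w)) (fun w => `|Y w|)).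
- exact: integ_sinY.
- exact: integ_absY.
- by move=> v w; exact: is_derive_sinM.
- move=> v w _; rewrite normrM -[leRHS]mulr1.
  by rewrite ler_wpM2l// cos_max.
- by rewrite ltrDl.
Qed.

Lemma is_derive_unique (f : R -> R) (u a b : R) :
  is_derive u 1 f a -> is_derive u 1 f b -> a = b.
Proof. by move=> [_ <-] [_ <-]. Qed.

Lemma C_derive (u : R) :
  Ex P Y (fun r => - (r * sin (u * r))) = dre u * C u - dim u * D u.
Proof.
apply: (is_derive_unique (is_derive_C u)).
have -> : C = (fun u => expR (LKre u) * cos (LKim u)).
  by apply/funext => v; exact: LKcos.
have h1 := is_derive_LKre u; have h2 := is_derive_LKim u.
rewrite -/C LKsin.
by apply: is_derive_eq; rewrite /GRing.scale /=; ring.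
Qed.

Lemma D_derive (u : R) :
  Ex P Y (fun r => r * cos (u * r)) = dre u * D u + dim u * C u.
Proof.
apply: (is_derive_unique (is_derive_D u)).
have -> : D = (fun u => expR (LKre u) * sin (LKim u)).
  by apply/funext => v; exact: LKsin.
have h1 := is_derive_LKre u; have h2 := is_derive_LKim u.
rewrite LKcos.
by apply: is_derive_eq; rewrite /GRing.scale /=; ring.
Qed.

Lemma drift_eq0 : g' = 0.
Proof.
have e1 : (fun r : R => r * cos (0 * r)) = id.
  by apply/funext => r; rewrite mul0r cos0 mulr1.
have e2 : (fun r : R => sin (0 * r)) = fun=> 0.
  by apply/funext => r; rewrite mul0r sin0.
have e3 : (fun r : R => cos (0 * r)) = fun=> 1.
  by apply/funext => r; rewrite mul0r cos0.
have := D_derive 0; rewrite /D /C /dim e1 e2 e3 EY0 !Ex_cst.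
under eq_Rintegral => x _ do rewrite mul0r cos0 subrr mulr0.
by rewrite Rintegral_cst// mul0r addr0 mulr0 add0r mulr1 => <-.
Qed.

Lemma jump_cos (v z : R) :
  jump P Y (fun r => cos (v * r)) z = (cos (v * z) - 1) * C v - sin (v * z) * D v.
Proof.
have ic := integ_cosY v; have is_ := integ_sinY v.
rewrite /C /D -(@ExZ _ _ _ P Y _ (fun r => cos (v * r)) ic).
rewrite -(@ExZ _ _ _ P Y _ (fun r => sin (v * r)) is_).
rewrite -(@ExB _ _ _ P Y (fun r => (cos (v * z) - 1) * cos (v * r))
  (fun r => sin (v * z) * sin (v * r)) (integZ _ ic) (integZ _ is_)).
by apply: eq_Rintegral => w _; rewrite mulrDr cosD; ring.
Qed.

Lemma jump_sin (v z : R) :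
  jump P Y (fun r => sin (v * r)) z = (cos (v * z) - 1) * D v + sin (v * z) * C v.
Proof.
have ic := integ_cosY v; have is_ := integ_sinY v.
rewrite /C /D -(@ExZ _ _ _ P Y _ (fun r => cos (v * r)) ic).
rewrite -(@ExZ _ _ _ P Y _ (fun r => sin (v * r)) is_).
rewrite -(@ExD _ _ _ P Y (fun r => (cos (v * z) - 1) * sin (v * r))
  (fun r => sin (v * z) * cos (v * r)) (integZ _ is_) (integZ _ ic)).
by apply: eq_Rintegral => w _; rewrite mulrDr sinD; ring.
Qed.

Lemma stein_cos (v : R) : stein P nu Y y q (jcos v).
Proof.
rewrite /stein /= D_derive /dre /dim drift_eq0 add0r.
have -> : Ex P Y (fun r => - (v * sin (v * r))) = - v * D v.
  rewrite -(@ExZ _ _ _ P Y _ (fun r => sin (v * r)) (integ_sinY v)).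
  by apply: eq_Rintegral => w _; ring.
have -> : \int[nu]_x (y x * jump P Y (fun r => cos (v * r)) (y x)) =
    (\int[nu]_x (y x * (cos (v * y x) - 1))) * C v -
    (\int[nu]_x (y x * sin (v * y x))) * D v.
  rewrite -(RintegralZr _ measurableT (integ_ycosB1 v)).
  rewrite -(RintegralZr _ measurableT (integ_ysin v)).
  rewrite -RintegralB//.
  - by apply: eq_Rintegral => x _; rewrite jump_cos; ring.
  - have := integZ (C v) (integ_ycosB1 v); congr integ.
    by apply/funext => x; rewrite mulrC.
  - have := integZ (D v) (integ_ysin v); congr integ.
    by apply/funext => x; rewrite mulrC.
by ring.
Qed.

Lemma stein_sin (v : R) : stein P nu Y y q (jsin v).
Proof.
have h := C_derive v.
have e : Ex P Y (fun r => - (r * sin (v * r))) = - Ex P Y (fun r => r * sin (v * r)).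
  rewrite -[RHS]mulN1r -(@ExZ _ _ _ P Y _ (fun r => r * sin (v * r))).
    by apply: eq_Rintegral => w _; rewrite mulN1r.
  exact: (integ_Yjet mY Y2 (C1b_sin v)).
rewrite e /dre /dim drift_eq0 add0r in h.
rewrite /stein /=.
have -> : Ex P Y (fun r => v * cos (v * r)) = v * C v.
  by rewrite -(@ExZ _ _ _ P Y _ (fun r => cos (v * r)) (integ_cosY v)).
have -> : \int[nu]_x (y x * jump P Y (fun r => sin (v * r)) (y x)) =
    (\int[nu]_x (y x * (cos (v * y x) - 1))) * D v +
    (\int[nu]_x (y x * sin (v * y x))) * C v.
  rewrite -(RintegralZr _ measurableT (integ_ycosB1 v)).
  rewrite -(RintegralZr _ measurableT (integ_ysin v)).
  rewrite -RintegralD//.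
  - by apply: eq_Rintegral => x _; rewrite jump_sin; ring.
  - have := integZ (D v) (integ_ycosB1 v); congr integ.
    by apply/funext => x; rewrite mulrC.
  - have := integZ (C v) (integ_ysin v); congr integ.
    by apply/funext => x; rewrite mulrC.
by rewrite -[LHS]opprK h; ring.
Qed.

End levy_khintchine_stein.

(** * Supports and cones in R^d *)

Section borel_rV.
Context (R : realType) (d : nat).
Implicit Types (t x : 'rV[R]_d) (nu : {measure set 'rV[R]_d -> \bar R}).

Lemma measurable_open (U : set 'rV[R]_d) : open U -> measurable U.
Proof. by move=> oU; apply: sub_sigma_algebra. Qed.

Lemma continuous_measurable_rV (f : 'rV[R]_d -> R) :
  continuous f -> measurable_fun setT f.
Proof.
move=> cf; apply: (measurability _ (RGenOpens.measurableE R)).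
move=> _ [_ [a [b ->]] <-]; rewrite setTI; apply: measurable_open.
by apply: open_comp => // x _; exact: cf.
Qed.

Lemma continuous_sum_mul (T : topologicalType) (f g : 'I_d -> T -> R) :
  (forall i, continuous (f i)) -> (forall i, continuous (g i)) ->
  continuous (fun z => \sum_(i < d) f i z * g i z).
Proof.
move=> cf cg; apply: (continuous_big (@add_continuous R)) => i _ z.
by apply: cvgM; [exact: cf|exact: cg].
Qed.

Lemma continuous_dotv t : continuous (dotv t).
Proof.
apply: (@continuous_sum_mul _ (fun i _ => t ord0 i)
  (fun i (x : 'rV[R]_d) => x ord0 i)) => i.
  by move=> x; exact: cst_continuous.
exact: coord_continuous.
Qed.

Lemma continuous_eucl_norm : continuous (@eucl_norm R d).
Proof.
have c : continuous (fun x : 'rV[R]_d => dotv x x).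
  by apply: (@continuous_sum_mul _ (fun i (x : 'rV[R]_d) => x ord0 i)
    (fun i (x : 'rV[R]_d) => x ord0 i)) => i; exact: coord_continuous.
by move=> x; apply: continuous_comp; [exact: c|exact: sqrt_continuous].
Qed.

Lemma dotvZl (s : R) t x : dotv (s *: t) x = s * dotv t x.
Proof. by rewrite /dotv mulr_sumr; apply: eq_bigr => i _; rewrite !mxE mulrA. Qed.

Lemma dotvZr (s : R) t x : dotv t (s *: x) = s * dotv t x.
Proof. by rewrite /dotv mulr_sumr; apply: eq_bigr => i _; rewrite !mxE mulrCA. Qed.

Lemma dotv0 t : dotv t 0 = 0.
Proof. by rewrite /dotv big1// => i _; rewrite mxE mulr0. Qed.

Lemma dotv_sumr (I : Type) (r : seq I) (F : I -> 'rV[R]_d) t :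
  dotv t (\sum_(i <- r) F i) = \sum_(i <- r) dotv t (F i).
Proof.
rewrite /dotv exchange_big /=; apply: eq_bigr => i _.
by rewrite summxE mulr_sumr.
Qed.

Lemma eucl_norm_ge0 x : 0 <= eucl_norm x.
Proof. exact: sqrtr_ge0. Qed.

Lemma sqr_eucl_norm x : eucl_norm x ^+ 2 = \sum_(i < d) x ord0 i ^+ 2.
Proof.
rewrite sqr_sqrtr; first by apply: eq_bigr => i _; rewrite expr2.
by apply: sumr_ge0 => i _; rewrite -expr2 sqr_ge0.
Qed.

Lemma coord_le_eucl x i : `|x ord0 i| <= eucl_norm x.
Proof.
rewrite -(@ler_pXn2r _ 2)// ?nnegrE ?eucl_norm_ge0//.
rewrite real_normK ?num_real// sqr_eucl_norm (bigD1 i)//= lerDl.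
by apply: sumr_ge0 => j _; exact: sqr_ge0.
Qed.

Lemma norm_dotv_le t x : `|dotv t x| <= (\sum_(i < d) `|t ord0 i|) * eucl_norm x.
Proof.
rewrite (le_trans (ler_norm_sum _ _ _))// mulr_suml ler_sum// => i _.
by rewrite normrM ler_wpM2l// coord_le_eucl.
Qed.

Lemma compact_null nu (A : set 'rV[R]_d) : compact A ->
  (forall x, A x -> ~ msupport nu x) -> nu.-negligible A.
Proof.
rewrite compact_cover => cA hA.
pose D := [set U : set 'rV[R]_d | open U /\ nu U = 0%E].
have [||D' D'D hD'] := cA _ D id.
- by move=> U [].
- move=> x /hA /existsNP[U /not_implyP[oU /not_implyP[Ux /negP]]].
  rewrite -leNgt measure_le0 => /eqP U0.
  by exists U.
set B := cover _ _ in hD'.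
have [mB B0] : measurable B /\ nu B = 0%E.
  rewrite /B /cover bigcup_fset big_seq.
  apply: (@big_ind _ (fun B => measurable B /\ nu B = 0%E)).
  - by rewrite measure0.
  - move=> A1 A2 [m1 z1] [m2 z2]; split; first exact: measurableU.
    by rewrite measureU0.
  - by move=> U /D'D; rewrite inE => -[oU U0]; split => //; exact: measurable_open.
by exists B.
Qed.

Lemma msupport_halfspace nu t :
  (nu [set x | 0 < dotv t x] = 0%E) <-> (forall x, msupport nu x -> dotv t x <= 0).
Proof.
have oN : open [set x | 0 < dotv t x].
  by apply: (open_comp _ (@open_gt R 0)) => x _; exact: continuous_dotv.
split=> [N0 x hx|h].
  by rewrite leNgt; apply/negP => tx; have := hx _ oN tx; rewrite N0 ltxx.
apply: (measure_negligible (measurable_open oN)).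
pose K n : set 'rV[R]_d := [set x | n.+1%:R^-1 <= dotv t x] `&` [set x | `|x| <= n%:R].
apply: (@negligibleS _ _ _ _ (\bigcup_n K n)); last first.
  apply: negligible_bigcup => n; apply: compact_null.
    apply: bounded_closed_compact.
      by exists n%:R; split => [|M nM x [_ /= xn]]; rewrite ?num_real// (le_trans xn)// ltW.
    apply: closedI.
      by apply: (preimage_closed _ (@closed_ge R _)) => x _; exact: continuous_dotv.
    by apply: (preimage_closed _ (@closed_le R _)) => x _; exact: norm_continuous.
  move=> x [/= tx _] /h; rewrite leNgt => /negP; apply.
  by apply: lt_le_trans tx; rewrite invr_gt0.
move=> x /= tx.
pose n := maxn (Num.truncn (dotv t x)^-1) (Num.truncn `|x|).+1.
exists n => //; split => /=.
  rewrite -[leRHS]invrK lef_pV2 ?posrE ?invr_gt0//.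
  by rewrite ltW// (lt_le_trans (truncnS_gt _))// ler_nat ltnS leq_maxl.
by rewrite ltW// (lt_le_trans (truncnS_gt _))// ler_nat leq_maxr.
Qed.

Lemma positive_jump_radius_eq0 nu t : positive_jump_radius nu t = 0%E <->
  (forall x, msupport nu x -> dotv t x <= 0).
Proof.
rewrite /positive_jump_radius; set S := [set _ | x in _].
have S0 : (0 <= ereal_sup S)%E.
  apply: ereal_sup_ubound; exists 0; first by right.
  by rewrite dotv0 maxxx.
split=> [h x hx|h].
  have : ((Num.max (dotv t x) 0)%:E <= ereal_sup S)%E.
    by apply: ereal_sup_ubound; exists x => //; left.
  by rewrite h lee_fin ge_max => /andP[].
apply/eqP; rewrite eq_le S0 andbT; apply: ge_ereal_sup => _ [x [hx|->] <-].
  by rewrite lee_fin ge_max h// lexx.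
by rewrite dotv0 maxxx.
Qed.

Lemma polar_msupport nu t : polar_cone (closed_conic_hull (msupport nu)) t <->
  (forall x, msupport nu x -> dotv t x <= 0).
Proof.
split=> [h x hx|h].
  apply: h; apply: subset_closure.
  exists 1%N, (fun=> 1), (fun=> x); split => //.
  by rewrite big_ord_recl big_ord0 addr0 scale1r.
have cl : closed [set x | dotv t x <= 0].
  by apply: (preimage_closed _ (@closed_le R _)) => x _; exact: continuous_dotv.
have sub : conic_hull (msupport nu) `<=` [set x | dotv t x <= 0].
  move=> _ [n [a [v [hv ->]]]] /=.
  rewrite dotv_sumr; apply: sumr_le0 => i _; rewrite dotvZr.
  by have [a0 /h] := hv i; exact: mulr_ge0_le0.
move=> x hx; have : closure [set x | dotv t x <= 0] x by exact: closureS sub _ hx.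
by rewrite -(proj1 (closure_id _) cl).
Qed.

End borel_rV.

(** * One-dimensional projections *)

Section directional_projection.
Context (R : realType) (d : nat) dO (Omega : measurableType dO).
Context (P : probability Omega R) (X : {RV P >-> 'rV[R]_d}).
Variable nu : {measure set 'rV[R]_d -> \bar R}.
Hypotheses (hL2 : finite_second_moment X) (hcent : centered X).
Hypothesis hnu : is_levy_measure_of X nu.
Implicit Types t u : 'rV[R]_d.

Lemma measurable_RV (f : 'rV[R]_d -> R) : continuous f ->
  measurable_fun setT (fun w => f (X w)).
Proof.
move=> cf.
by apply: (measurableT_comp (continuous_measurable_rV cf)).
Qed.

Lemma fine_expectation (f : Omega -> R) : fine 'E_P[f]%E = \int[P]_w f w.
Proof. by rewrite unlock. Qed.

Lemma integ_eucl_norm2 : integ P (fun w => eucl_norm (X w) ^+ 2).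
Proof.
have m : measurable_fun setT (fun w => eucl_norm (X w) ^+ 2).
  apply: measurable_funX; exact: measurable_RV (@continuous_eucl_norm _ _).
apply/integrableP; split; first exact/measurable_EFinP.
have := hL2; rewrite /finite_second_moment unlock; apply: le_lt_trans.
rewrite (eq_integral (fun w => (eucl_norm (X w) ^+ 2)%:E))// => w _.
by rewrite /= ger0_norm ?sqr_ge0.
Qed.

Lemma measurable_dotX t : measurable_fun setT (fun w => dotv t (X w)).
Proof. exact: measurable_RV (@continuous_dotv _ _ t). Qed.

Lemma measurable_coordX i : measurable_fun setT (fun w => X w ord0 i).
Proof. exact: measurable_RV (@coord_continuous _ _ _ ord0 i). Qed.

Lemma integ_coordM i j : integ P (fun w => X w ord0 i * X w ord0 j).
Proof.
apply: le_integ integ_eucl_norm2.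
  by apply: measurable_funM; exact: measurable_coordX.
by move=> w; rewrite normrM expr2 ler_pM// coord_le_eucl.
Qed.

Lemma integ_coord i : integ P (fun w => X w ord0 i).
Proof.
apply: (@integ_Y _ _ _ P (fun w => X w ord0 i)); first exact: measurable_coordX.
exact: integ_coordM.
Qed.

Lemma integ_dotX2 t : integ P (fun w => dotv t (X w) ^+ 2).
Proof.
apply: (@le_integ _ _ _ _ _
  (fun w => (\sum_(i < d) `|t ord0 i|) ^+ 2 * eucl_norm (X w) ^+ 2)).
- by apply: measurable_funX; exact: measurable_dotX.
- move=> w; rewrite normrX -exprMn lerXn2r ?nnegrE ?norm_dotv_le//.
  by rewrite mulr_ge0 ?eucl_norm_ge0// sumr_ge0.
- by apply: integZ; exact: integ_eucl_norm2.
Qed.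

Lemma mean_coord i : \int[P]_w X w ord0 i = 0.
Proof. by rewrite -fine_expectation hcent. Qed.

Lemma mean_dotX t : \int[P]_w dotv t (X w) = 0.
Proof.
rewrite (proj2 (@integ_sum _ _ _ P _ _ (fun i w => t ord0 i * X w ord0 i) _)).
  rewrite big1// => i _; rewrite RintegralZl ?mean_coord ?mulr0//.
  exact: integ_coord.
by move=> i; apply: integZ; exact: integ_coord.
Qed.

Lemma covariance_matrixE i j :
  covariance_matrix X i j = \int[P]_w (X w ord0 i * X w ord0 j).
Proof.
rewrite mxE covariance.unlock fine_expectation !fine_expectation !mean_coord.
apply: eq_Rintegral => w _.
by rewrite -[LHS]/((X w ord0 i - 0) * (X w ord0 j - 0)) !subr0.
Qed.

Lemma dir_varianceE t : dir_variance X t = \int[P]_w (dotv t (X w) ^+ 2).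
Proof.
have i1 i j : integ P (fun w => t ord0 i * t ord0 j * (X w ord0 i * X w ord0 j)).
  by apply: integZ; exact: integ_coordM.
have i2 i : integ P (fun w => \sum_(j < d) t ord0 i * t ord0 j * (X w ord0 i * X w ord0 j)).
  exact: (proj1 (integ_sum _ (i1 i))).
transitivity (\int[P]_w \sum_(i < d) \sum_(j < d)
    t ord0 i * t ord0 j * (X w ord0 i * X w ord0 j)); last first.
  apply: eq_Rintegral => w _; rewrite expr2 /dotv big_distrlr /=.
  by apply: eq_bigr => i _; apply: eq_bigr => j _; ring.
rewrite (proj2 (integ_sum _ i2)) /dir_variance /quad_form mxE.
rewrite [RHS](eq_bigr (fun i => \sum_(j < d)
    t ord0 i * t ord0 j * covariance_matrix X i j)); last first.
  move=> i _; rewrite (proj2 (integ_sum _ (i1 i))).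
  apply: eq_bigr => j _; rewrite covariance_matrixE.
  by rewrite RintegralZl//; exact: integ_coordM.
rewrite exchange_big /=; apply: eq_bigr => j _.
by rewrite !mxE mulr_suml; apply: eq_bigr => i _; ring.
Qed.

Lemma integ_levy_min : integ nu (fun x => Num.min 1 (eucl_norm x ^+ 2)).
Proof.
case: hnu => _ h _.
apply/integrableP; split.
  apply/measurable_EFinP; apply: measurable_minr; first exact: measurable_cst.
  by apply: measurable_funX; exact: continuous_measurable_rV (@continuous_eucl_norm _ _).
rewrite (_ : (\int[nu]_x _)%E =
  (\int[nu]_x (Num.min 1 (eucl_norm x ^+ 2))%R%:E)%E) //.
apply: eq_integral => x _.
by rewrite /= ger0_norm// le_min ler01 sqr_ge0.
Qed.

Lemma directional_stein t : exists q : R, [/\ 0 <= q,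
  integ nu (fun x => dotv t x ^+ 2),
  forall v, stein P nu (fun w => dotv t (X w)) (dotv t) q (jcos v) &
  forall v, stein P nu (fun w => dotv t (X w)) (dotv t) q (jsin v)].
Proof.
have [_ _ [gam [A [[_ Apsd] hLK]]]] := hnu.
set q := quad_form A t; set Y := fun w => dotv t (X w).
have q0 : 0 <= q by exact: Apsd.
have mY : measurable_fun setT Y by exact: measurable_dotX.
have Y2 : integ P (fun w => Y w ^+ 2) by exact: integ_dotX2.
have EY0 : Ex P Y id = 0 by exact: mean_dotX.
have my : measurable_fun setT (dotv t).
  exact: continuous_measurable_rV (@continuous_dotv _ _ t).
have mnm : measurable_fun setT (@eucl_norm R d).
  exact: continuous_measurable_rV (@continuous_eucl_norm _ _).
pose K := \sum_(i < d) `|t ord0 i|.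
have K0 : 0 <= K by exact: sumr_ge0.
have quadZ (u : R) : quad_form A (u *: t) = q * u ^+ 2.
  by rewrite /q /quad_form linearZ /= -scalemxAl -scalemxAl -scalemxAr !mxE; ring.
have reE (u : R) : LK_exponent_Re A nu (u *: t) =
    - (q * u ^+ 2 / 2) + \int[nu]_x (cos (u * dotv t x) - 1).
  rewrite /LK_exponent_Re quadZ; congr (_ + _).
  by apply: eq_Rintegral => x _; rewrite dotvZl.
have imE (u : R) : LK_exponent_Im gam nu (u *: t) = dotv gam t * u +
    \int[nu]_x (sin (u * dotv t x) - (if eucl_norm x <= 1 then u * dotv t x else 0)).
  rewrite /LK_exponent_Im dotvZr mulrC; congr (_ + _).
  by apply: eq_Rintegral => x _; rewrite dotvZl.
have hcos (u : R) : Ex P Y (fun r => cos (u * r)) =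
    expR (- (q * u ^+ 2 / 2) + \int[nu]_x (cos (u * dotv t x) - 1)) *
    cos (dotv gam t * u + \int[nu]_x (sin (u * dotv t x) -
      (if eucl_norm x <= 1 then u * dotv t x else 0))).
  have [+ _] := hLK (u *: t); rewrite -reE -imE => /(congr1 fine) /= <-.
  by rewrite fine_expectation; apply: eq_Rintegral => w _; rewrite dotvZl.
have hsin (u : R) : Ex P Y (fun r => sin (u * r)) =
    expR (- (q * u ^+ 2 / 2) + \int[nu]_x (cos (u * dotv t x) - 1)) *
    sin (dotv gam t * u + \int[nu]_x (sin (u * dotv t x) -
      (if eucl_norm x <= 1 then u * dotv t x else 0))).
  have [_ +] := hLK (u *: t); rewrite -reE -imE => /(congr1 fine) /= <-.
  by rewrite fine_expectation; apply: eq_Rintegral => w _; rewrite dotvZl.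
exists q; split; first exact: q0.
- exact: (integ_y2 mY Y2 my (norm_dotv_le t) (@eucl_norm_ge0 R d) K0 integ_levy_min q0 hcos).
- exact: (stein_cos mY Y2 EY0 my mnm (norm_dotv_le t) (@eucl_norm_ge0 R d) K0
    integ_levy_min q0 hcos hsin).
- exact: (stein_sin mY Y2 EY0 my mnm (norm_dotv_le t) (@eucl_norm_ge0 R d) K0
    integ_levy_min q0 hcos hsin).
Qed.

Lemma dir_variance_ge0 t : 0 <= dir_variance X t.
Proof. by rewrite dir_varianceE; apply: Rintegral_ge0 => w _; exact: sqr_ge0. Qed.

Lemma null_halfspace_union t :
  (forall e : R, 0 < e -> nu [set x | e < dotv t x] = 0%E) ->
  nu [set x | 0 < dotv t x] = 0%E.
Proof.
have m c : measurable [set x | c < dotv t x].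
  exact: measurable_gt (continuous_measurable_rV (@continuous_dotv _ _ t)).
move=> h; apply: (measure_negligible (m 0)).
apply: (@negligibleS _ _ _ _ (\bigcup_n [set x | n.+1%:R^-1 < dotv t x])); last first.
  by apply: negligible_bigcup => n; apply/negligibleP => //; apply: h; rewrite invr_gt0.
move=> x /= tx; exists (Num.truncn (dotv t x)^-1) => //=.
by rewrite -[ltRHS]invrK ltf_pV2 ?posrE ?invr_gt0// truncnS_gt.
Qed.

Lemma exp_integral_leP t (s B : R) :
  (cumulant_gen_fun X (s *: t) <= B%:E)%E <->
  integ P (fun w => expR (s * dotv t (X w))) /\
  Ex P (fun w => dotv t (X w)) (fun r => expR (s * r)) <= expR B.
Proof.
have m : measurable_fun setT (fun w => expR (s * dotv t (X w))).
  apply: (measurableT_comp (continuous_measurable_fun (@continuous_expR R))).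
  by apply: measurable_funM => //; exact: measurable_dotX.
set I := (\int[P]_w (expR (s * dotv t (X w)))%:E)%E.
have EI : ('E_P[fun w => expR (dotv (s *: t) (X w))] = I)%E.
  by rewrite unlock; apply: eq_integral => w _; rewrite dotvZl.
have I0 : (0 <= I)%E by apply: integral_ge0 => w _; rewrite lee_fin expR_ge0.
have lI : expeR (lne I) = I by rewrite lneK// in_itv/= I0 leey.
rewrite /cumulant_gen_fun EI -lee_expeR lI /=; split=> [h|[hi hB]].
  have hi : integ P (fun w => expR (s * dotv t (X w))).
    apply/integrableP; split; first exact/measurable_EFinP.
    apply: le_lt_trans (ltry (expR B)); apply: le_trans h.
    rewrite (eq_integral (fun w => (expR (s * dotv t (X w)))%:E))// => w _.
    by rewrite /= ger0_norm ?expR_ge0.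
  split => //; rewrite -lee_fin /Ex /Rintegral fineK//.
  exact: integrable_fin_num hi.
rewrite -lee_fin /Ex /Rintegral fineK// in hB.
exact: integrable_fin_num hi.
Qed.

Lemma radial_pole_eq0 t :
  (radial_pole X t = 0%E) <-> (nu [set x | 0 < dotv t x] = 0%E).
Proof.
have [q [q0 y2 Sc Ss]] := directional_stein t.
have mY := measurable_dotX t; have Y2 := integ_dotX2 t.
have my := continuous_measurable_rV (@continuous_dotv _ _ t).
have hV := dir_varianceE t.
rewrite /radial_pole; case: ifPn => [V0|V0]; last first.
  split=> // _; apply: null_halfspace_union => e e0.
  have Vz : dir_variance X t = 0.
    by apply/eqP; rewrite eq_le dir_variance_ge0 andbT leNgt.
  have hv := stein_variance mY Y2 my y2 Sc Ss.
  have y0 : \int[nu]_x dotv t x ^+ 2 = 0.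
    have : 0 <= \int[nu]_x dotv t x ^+ 2.
      by apply: Rintegral_ge0 => x _; exact: sqr_ge0.
    rewrite /Ex -hV Vz in hv; lra.
  have m : measurable_fun setT (fun x : 'rV[R]_d => (dotv t x ^+ 2)%:E : \bar R).
    by apply/measurable_EFinP; exact: integ_measurable y2.
  have [h _] := ae_eq_integral_abs nu measurableT m.
  have /h : (\int[nu]_x `|(dotv t x ^+ 2)%:E| = 0)%E.
    rewrite (eq_integral (fun x => (dotv t x ^+ 2)%:E)); last first.
      by move=> x _; rewrite /= ger0_norm// sqr_ge0.
    have <- : (\int[nu]_x dotv t x ^+ 2)%:E = 0%E by rewrite y0.
    by rewrite /Rintegral fineK//; exact: integrable_fin_num y2.
  move=> ae0; apply: measure_negligible; first exact: measurable_gt.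
  apply: negligibleS ae0 => x /= ex /(_ I) [] /eqP.
  by rewrite sqrf_eq0 gt_eqF// (lt_trans e0).
set S := [set c%:E | c in _].
have S0 : (0 <= ereal_inf S)%E.
  by apply: le_ereal_inf_tmp => _ [c [c0 _] <-]; rewrite lee_fin.
split=> [h|N0].
  apply: null_halfspace_union => e e0.
  apply: (no_positive_jump mY Y2 my y2 Sc Ss q0 e0 (ltW V0)) => s s0.
  apply/exp_integral_leP; apply/lee_addgt0Pr => eps eps0.
  set B := dir_variance X t * s ^+ 2 / 2.
  have B0 : 0 <= B by rewrite divr_ge0// mulr_ge0 ?sqr_ge0// ltW.
  pose del := eps / ((B + eps) * (s + 1)).
  have Be : 0 < B + eps by rewrite ltr_wpDl.
  have s1 : 0 < s + 1 by rewrite ltr_wpDl.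
  have del0 : 0 < del by rewrite divr_gt0// mulr_gt0.
  have : (ereal_inf S < del%:E)%E by rewrite h lte_fin.
  move=> /ereal_inf_lt[_ [c [c0 hc] <-]]; rewrite lte_fin => cdel.
  have cs : (B + eps) * (c * s) < eps.
    have : c * ((B + eps) * (s + 1)) < eps by rewrite -ltr_pdivlMr// mulr_gt0.
    have : 0 <= c * (B + eps) by rewrite mulr_ge0// ltW.
    by lra.
  have cs1 : c * s < 1.
    by rewrite -(ltr_pM2l Be) mulr1; lra.
  have /hc := s0 => /(_ _)/le_trans; apply.
    rewrite inver; case: ifPn => [_|cn0]; first exact: ltry.
    have cp : 0 < c by rewrite lt_neqAle eq_sym cn0.
    by rewrite lte_fin -[ltRHS]mulr1 ltr_pdivlMl.
  rewrite -EFinD lee_fin -/B ler_pdivrMr ?mulr_gt0 ?subr_gt0//.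
  have : dir_variance X t * s ^+ 2 = 2 * B by rewrite /B; field.
  by lra.
apply/eqP; rewrite eq_le S0 andbT; apply: ereal_inf_lbound.
exists 0 => //; split=> // s s0 _.
rewrite mul0r subr0 mulr1; apply/exp_integral_leP.
have := exp_moment_le mY Y2 my y2 Sc Ss q0 s0 N0.
by rewrite /Ex -hV.
Qed.

End directional_projection.

Theorem corollary3p5 (R : realType) (d : nat) (disp : measure_display)
  (Omega : measurableType disp) (P : probability Omega R)
  (X : {RV P >-> 'rV[R]_d}) (nu : {measure set 'rV[R]_d -> \bar R})
  (hid : infinitely_divisible X) (hL2 : finite_second_moment X)
  (hcent : centered X) (hnu : is_levy_measure_of X nu) :
  [set t : 'rV[R]_d | radial_pole X t = 0%E] =
    [set t : 'rV[R]_d | positive_jump_radius nu t = 0%E] /\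
  [set t : 'rV[R]_d | positive_jump_radius nu t = 0%E] =
    polar_cone (closed_conic_hull (msupport nu)).
Proof.
split; apply/seteqP; split=> t /=.
- move=> /(radial_pole_eq0 hL2 hcent hnu)/msupport_halfspace.
  by move/positive_jump_radius_eq0.
- move/positive_jump_radius_eq0/msupport_halfspace.
  by move/(radial_pole_eq0 hL2 hcent hnu).
- by move/positive_jump_radius_eq0/polar_msupport.
- by move/polar_msupport/positive_jump_radius_eq0.
Qed.
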